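(* For every integer $t\geq 3$ there exists $\delta>0$ such that the following holds. If $G$ is a graph with $n$ vertices and at most $\frac{1}{2(t-1)}\cdot\frac{n^{2}}{2}$ edges such that $G$ does not contain an induced weak-subdivision of $K_{t}$, then $\overline{G}$ contains a bi-clique of size at least $\delta n$.
   Context: $\overline{G}$ is the complement of $G$. A bi-clique in a graph is a pair of disjoint vertex sets $(A,B)$ with $|A|=|B|$ and $ab$ an edge for all $a\in A$, $b\in B$; its size is $|A|$. A subdivision of a graph $H$ is obtained by replacing each edge $xy$ by a path from $x$ to $y$ with $k\ge1$ new internal vertices ($k$ may depend on the edge); the new vertices are side-vertices. A weak-subdivision of $H$ is a graph obtained from some subdivision of $H$ by adding edges, each joining two side-vertices lying on the subdivisions of two distinct edges of $H$ that share an endpoint.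
   Formalization: The case n = 1 is excluded: the one-vertex graph meets every hypothesis, but its complement has only the empty bi-clique, of size 0 < δ, so the statement fails there for every δ > 0. *)

(* Defs.v *)
From HB Require Import structures.
From mathcomp Require Import all_boot all_order all_algebra.
From mathcomp Require Import reals.

Set Implicit Arguments.
Unset Strict Implicit.
Unset Printing Implicit Defensive.

Record sgraph := SGraph {
  vertex :> finType;
  adj : rel vertex;
  adj_sym : symmetric adj;
  adj_irr : irreflexive adj }.

Arguments adj {s}.

Definition edges (G : sgraph) : {set {set G}} :=
  [set [set p.1; p.2] | p : G * G & adj p.1 p.2].

Section Complement.
Variable G : sgraph.

Definition compl_adj : rel G := fun x y => (x != y) && ~~ adj x y.

Lemma compl_adj_sym : symmetric compl_adj.
Proof. by move=> x y; rewrite /compl_adj eq_sym adj_sym. Qed.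

Lemma compl_adj_irr : irreflexive compl_adj.
Proof. by move=> x; rewrite /compl_adj eqxx. Qed.

Definition compl : sgraph := SGraph compl_adj_sym compl_adj_irr.

End Complement.

Section Induced.
Variables (G : sgraph) (A : {set G}).

Definition induced_adj : rel {x : G | x \in A} := fun x y => adj (val x) (val y).

Lemma induced_adj_sym : symmetric induced_adj.
Proof. by move=> x y; rewrite /induced_adj adj_sym. Qed.

Lemma induced_adj_irr : irreflexive induced_adj.
Proof. by move=> x; rewrite /induced_adj adj_irr. Qed.

Definition induced : sgraph := SGraph induced_adj_sym induced_adj_irr.

End Induced.

Section Complete.
Variable t : nat.

Definition complete_adj : rel 'I_t := fun x y => x != y.

Lemma complete_adj_sym : symmetric complete_adj.
Proof. by move=> x y; rewrite /complete_adj eq_sym. Qed.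

Lemma complete_adj_irr : irreflexive complete_adj.
Proof. by move=> x; rewrite /complete_adj eqxx. Qed.

Definition complete : sgraph := SGraph complete_adj_sym complete_adj_irr.

End Complete.

Definition biclique (G : sgraph) (A B : {set G}) : Prop :=
  [/\ [disjoint A & B], #|A| = #|B|
    & forall a b, a \in A -> b \in B -> adj a b].

Section Subdivision.
Variable H : sgraph.

(* Every edge xy of H is represented exactly once, by the pair (x, y) in which
   x precedes y in the enumeration of the vertices; this fixes the direction in
   which the internal vertices 0, ..., k - 1 of its subdividing path are
   numbered. *)
Definition oedge : finType :=
  {p : H * H | adj p.1 p.2 && (enum_rank p.1 < enum_rank p.2)}.

Definition src (e : oedge) : H := (val e).1.
Definition tgt (e : oedge) : H := (val e).2.

Definition share_endpoint (e f : oedge) : bool :=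
  ~~ [disjoint [set src e; tgt e] & [set src f; tgt f]].

Variable k : oedge -> nat.

Definition side_vertex : finType := {e : oedge & 'I_(k e)}.

(* inl: original vertices of H; inr: side-vertices. *)
Definition subdiv_vertex : finType := (H + side_vertex)%type.

Definition end_adj (x : H) (s : side_vertex) : bool :=
  ((x == src (tag s)) && (tagged s == 0 :> nat)) ||
  ((x == tgt (tag s)) && ((tagged s).+1 == k (tag s))).

Definition side_adj (s s' : side_vertex) : bool :=
  (tag s == tag s') &&
  (((tagged s).+1 == tagged s' :> nat) || ((tagged s').+1 == tagged s :> nat)).

(* Original vertices are pairwise nonadjacent, which is correct only when every
   k e is positive; this is required wherever subdiv is used. *)
Definition subdiv_adj : rel subdiv_vertex := fun u v =>
  match u, v with
  | inl _, inl _ => false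
  | inl x, inr s => end_adj x s
  | inr s, inl x => end_adj x s
  | inr s, inr s' => side_adj s s'
  end.

Lemma subdiv_adj_sym : symmetric subdiv_adj.
Proof. by case=> [x|s] [y|s'] //=; rewrite /side_adj eq_sym orbC. Qed.

Lemma subdiv_adj_irr : irreflexive subdiv_adj.
Proof. by case=> [x|s] //=; rewrite /side_adj !eqn_leq !ltnn /= andbF. Qed.

Definition subdiv : sgraph := SGraph subdiv_adj_sym subdiv_adj_irr.

Definition weak_pair (u v : subdiv_vertex) : bool :=
  match u, v with
  | inr s, inr s' => (tag s != tag s') && share_endpoint (tag s) (tag s')
  | _, _ => false
  end.

End Subdivision.

(* W is, up to isomorphism f, a subdivision of H plus additional edges. *)
Definition weak_subdivision (H W : sgraph) : Prop :=
  exists k : oedge H -> nat, (forall e, 0 < k e) /\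
  exists f : W -> subdiv k,
    [/\ bijective f,
        forall x y, adj (f x) (f y) -> adj x y
      & forall x y, adj x y -> ~~ adj (f x) (f y) -> weak_pair (f x) (f y)].

Definition has_induced_weak_subdivision (G H : sgraph) : Prop :=
  exists A : {set G}, weak_subdivision H (induced A).

(* Main.v *)
(** Call a graph [m]-coherent if any two disjoint sets of [m] vertices are joined
    by an edge.  It suffices to show that an [m]-coherent graph on [n >= L m]
    vertices, with [L] large in terms of [t], satisfying the bound on the number
    of edges contains [t] pairwise nonadjacent branch vertices and, for any two
    of them, a connecting set of vertices, such that a set meets the
    neighbourhood of a branch vertex, or touches another set, only when the
    definition of a weak subdivision allows it; shortest paths inside these sets
    then form an induced weak subdivision of [K_t].  Deleting vertices of high
    degree gives a set [W] of linear size with maximum degree at most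
    [(1 - 1/33) |W| / (t - 1)], and three cases remain.

    If every linear subset of [W] spans a vertex of linear degree, choose linear
    sets [Y_1, ..., Y_t] almost minimising the sum of their pairwise densities.
    Exchanging [Y_k] for [W] shows that the densities from [Y_k] to the other
    sets add up to less than 1, and since the sum is affine in each [Y_k] the
    same holds for all linear subsets.  So one may choose [v_i] in [Y_i], shrink
    [Y_i] to a part of its neighbourhood, and successively choose edges [c c']
    between [Y_i] and [Y_j] that leave a positive proportion of every other
    [Y_k] unseen; the paths are [v_i c c' v_j].

    Otherwise some linear set has only vertices of small degree.  If in all its
    large subsets some vertex has a linear second neighbourhood, such vertices
    are the branch vertices, and routes of length two leave them; vertices that
    touch many routes of an earlier branch vertex are few and can be avoided.
    If finally all balls of radius two are small, grow connected sets until their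
    second neighbourhood reaches a small linear size; by coherence their first
    neighbourhood is then tiny, and routes leaving two such sets at distance at
    least three conflict only inside balls of radius two. *)

Require Import Defs.
From HB Require Import structures.
From mathcomp Require Import all_boot all_order all_algebra.
From mathcomp Require Import reals.
From mathcomp Require Import zify lra ring.

Set Implicit Arguments.
Unset Strict Implicit.
Unset Printing Implicit Defensive.

Import Order.TTheory GRing.Theory Num.Theory.

(** * Linked branch vertices *)

Section Graphs.
Variable G : sgraph.
Implicit Types (x y z : G) (A B Q S : {set G}).

Definition nb x : {set G} := [set y | adj x y].

Definition touch x y := (x == y) || adj x y.

(** A relation on all of [G] rather than on a subtype, so that connectivity inside different sets
    can be compared. Note that [connect (radj S) x x] holds even for [x] outside [S]. *)
Definition radj S : rel G := [rel x y | [&& x \in S, y \in S & adj x y]].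

Lemma touch_sym x y : touch x y = touch y x.
Proof. by rewrite /touch eq_sym adj_sym. Qed.

Lemma radj_sym S : symmetric (radj S).
Proof. by move=> x y; rewrite /radj /= adj_sym andbCA. Qed.

Lemma connect_radjC S x y : connect (radj S) x y = connect (radj S) y x.
Proof. exact: sym_connect_sym (radj_sym S) x y. Qed.

Lemma connect_radjS A B x y :
  A \subset B -> connect (radj A) x y -> connect (radj B) x y.
Proof.
move=> sAB; apply: connect_sub => u w /= /and3P[uA wA uw].
by apply: connect1; rewrite /radj /= (subsetP sAB _ uA) (subsetP sAB _ wA) uw.
Qed.

Lemma connect_crossing S A x y :
  connect (radj S) x y -> x \in A -> y \notin A ->
  exists u w, [/\ u \in A, w \notin A & radj S u w].
Proof.
case/connectP=> p; elim: p x => [|z p IHp] x /= => [_ ->|/andP[xz zp] yE] xA yA.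
  by rewrite xA in yA.
case: (boolP (z \in A)) => zA; first exact: (IHp z).
by exists x, z.
Qed.

Lemma shortest_path S x y : connect (radj S) x y ->
  exists p : seq G, [/\ path (radj S) x p, last x p = y &
    forall q, path (radj S) x q -> last x q = y -> size p <= size q].
Proof.
move=> xy.
have exn : exists n, [exists p : n.-tuple G, path (radj S) x p && (last x p == y)].
  case/connectP: xy => p xp ->; exists (size p); apply/existsP.
  by exists (in_tuple p); rewrite xp eqxx.
case: (ex_minnP exn) => n /existsP[p /andP[xp /eqP lp]] minn.
exists p; split=> // q xq lq; rewrite size_tuple; apply: minn.
by apply/existsP; exists (in_tuple q); rewrite xq lq eqxx.
Qed.

(** Two touching vertices more than one step apart would allow a shortcut: drop the segment between
    them if they coincide, replace it by one edge if they are adjacent. *)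
Lemma shortest_path_induced S x p :
  path (radj S) x p ->
  (forall q, path (radj S) x q -> last x q = last x p -> size p <= size q) ->
  forall i j, i.+1 < j -> j <= size p ->
    ~~ touch (nth x (x :: p) i) (nth x (x :: p) j).
Proof.
move=> xp minp i j ltij ljp; apply/negP => tij.
pose s := x :: p.
have si : i <= size p by lia.
have E1 : x :: take i p = take i.+1 s by [].
have last_i : last x (take i p) = nth x s i.
  by rewrite (last_nth x) E1 nth_take // size_takel // ltnSn.
have drop_j : drop j.-1 p = nth x s j :: drop j p.
  by case: j ltij ljp {tij} => // j ltij ljp; rewrite (drop_nth x) .
have pS : forall k, k <= size p -> 0 < size p -> nth x s k \in S.
  move=> k lk p0; case: k lk => [|k] lk.
    by case: (p) p0 xp => //= z q _ /andP[/and3P[]].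
  have /(pathP x) := xp => /(_ k); rewrite lk => /(_ isT).
  by rewrite /radj /= => /and3P[].
have p0 : 0 < size p by lia.
have pathd : path (radj S) (nth x s j) (drop j p).
  move: xp; rewrite -{1}(cat_take_drop j.-1 p) cat_path drop_j /=.
  by case/and3P.
have patht : path (radj S) x (take i p).
  by move: xp; rewrite -{1}(cat_take_drop i p) cat_path => /andP[].
have lastd : last (nth x s j) (drop j p) = last x p.
  by rewrite -{2}(cat_take_drop j.-1 p) last_cat drop_j.
case/orP: tij => [/eqP eij|aij].
  have := minp (take i p ++ drop j p).
  rewrite cat_path patht last_i last_cat last_i -/s eij pathd lastd.
  by move=> /(_ isT erefl); rewrite size_cat size_takel // size_drop; lia.
have := minp (take i p ++ nth x s j :: drop j p).
rewrite cat_path patht last_i last_cat last_i -/s /= pathd lastd /radj /= !pS ?aij //; try lia.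
by move=> /(_ isT erefl); rewrite size_cat size_takel //= size_drop; lia.
Qed.

(** A shortest path is induced, and its interior [s] is nonempty because the ends are distinct and
    nonadjacent. *)
Lemma induced_connecting_path Q x y :
    x != y -> ~~ adj x y -> x \notin Q -> y \notin Q ->
    connect (radj (x |: (y |: Q))) x y ->
  exists s : seq G,
    [/\ 0 < size s, {subset s <= Q},
     forall i j, i < size s -> j < size s ->
       adj (nth x s i) (nth x s j) = (i.+1 == j) || (j.+1 == i),
     forall i j, i < size s -> j < size s -> nth x s i = nth x s j -> i = j &
     (forall i, i < size s -> adj x (nth x s i) = (i == 0)) /\
     (forall i, i < size s -> adj y (nth x s i) = (i.+1 == size s))].
Proof.
move=> xy nxy xQ yQ /shortest_path[p [xp lp minp]].
have ind := shortest_path_induced xp (fun q qp lq => minp q qp (etrans lq lp)).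
have Pp : forall k, k < size p -> radj (x |: (y |: Q)) (nth x (x :: p) k) (nth x p k).
  by move=> k lk; have /(pathP x) := xp => /(_ k lk).
case/lastP: p => [|s z] in xp lp minp ind Pp *; first by rewrite -lp eqxx in xy.
rewrite last_rcons in lp; subst z.
rewrite size_rcons in ind Pp.
(* The whole path with both ends: position [i] of [s] is position [i.+1] of [t], so every claim
   becomes one about positions in [t]. *)
pose t := x :: rcons s y.
have ns i : i < size s -> nth x s i = nth x t i.+1 by move=> li; rewrite /= nth_rcons li.
have ny : y = nth x t (size s).+1 by rewrite /= nth_rcons ltnn eqxx.
have tt i j : i <= (size s).+1 -> j <= (size s).+1 ->
   touch (nth x t i) (nth x t j) -> [\/ i = j, i.+1 = j | j.+1 = i].
  move=> li lj tij; case: (ltngtP i j) => ij.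
  - case: (ltnP i.+1 j) => ij'; last by constructor 2; lia.
    by case/negP: (ind i j ij' lj).
  - case: (ltnP j.+1 i) => ij'; last by constructor 3; lia.
    by case/negP: (ind j i ij' li); rewrite touch_sym.
  by constructor 1.
have aa i : i <= size s -> adj (nth x t i) (nth x t i.+1).
  by move=> li; have /and3P[] := Pp i li.
have s0 : 0 < size s.
  rewrite lt0n; apply/eqP => s0; case/negP: nxy.
  by have := aa 0 (leq0n _); rewrite /t; case: (s) s0.
have ee i j : i <= (size s).+1 -> j <= (size s).+1 ->
   adj (nth x t i) (nth x t j) = (i.+1 == j) || (j.+1 == i).
  move=> li lj; apply/idP/idP => [aij|].
    case: (tt i j li lj); first by rewrite /touch aij orbT.
    - by move=> eij; rewrite eij adj_irr in aij.
    - by move=> ->; rewrite eqxx.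
    - by move=> ->; rewrite eqxx orbT.
  case/orP=> /eqP eij; first by rewrite -eij aa //; lia.
  by rewrite -eij adj_sym aa //; lia.
have uu i j : i <= (size s).+1 -> j <= (size s).+1 -> nth x t i = nth x t j -> i = j.
  move=> li lj eij; have: touch (nth x t i) (nth x t j) by rewrite /touch eij eqxx.
  case/(tt _ _ li lj) => // dij.
    by have := ee i j li lj; rewrite eij adj_irr -dij eqxx.
  by have := ee i j li lj; rewrite eij adj_irr -dij eqxx orbT.
exists s; split=> //.
- move=> _ /(nthP x)[i li <-]; have /and3P[_ + _] := Pp i (ltnW li).
  rewrite nth_rcons li !inE => /or3P[/eqP ex|/eqP ey|//].
    have E : nth x t i.+1 = nth x t 0 by rewrite -ns.
    by have := uu i.+1 0 (leqW li) isT E.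
  have E : nth x t i.+1 = nth x t (size s).+1 by rewrite -ns // -ny.
  by have [e] := uu i.+1 (size s).+1 (leqW li) (leqnn _) E; rewrite e ltnn in li.
- by move=> i j li lj; rewrite !ns // ee ?(leqW li) ?(leqW lj).
- by move=> i j li lj; rewrite !ns // => /(uu _ _ (leqW li) (leqW lj))[].
split=> i li; rewrite ns //.
  by rewrite (ee 0 i.+1) ?(leqW li) //= eqSS orbF eq_sym.
by rewrite [in LHS]ny ee ?(leqW li) //; lia.
Qed.

(* [v i] are the branch vertices; the path joining [v i] to [v j] is taken
   inside [Q i j], used only for [i < j < t]. *)
Definition linked t (v : nat -> G) (Q : nat -> nat -> {set G}) :=
  [/\ forall i j, i < j < t -> v i != v j /\ ~~ adj (v i) (v j),
      forall i j, i < j < t -> connect (radj (v i |: (v j |: Q i j))) (v i) (v j),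
      forall i j k, i < j < t -> k < t -> v k \notin Q i j /\
        (k != i -> k != j -> forall x, x \in Q i j -> ~~ adj (v k) x) &
      forall i j k l, i < j < t -> k < l < t -> (i, j) != (k, l) ->
        [disjoint Q i j & Q k l] /\
        ([&& i != k, i != l, j != k & j != l] ->
          forall x y, x \in Q i j -> y \in Q k l -> ~~ adj x y)].

Definition weakly_linked t := 
  exists (v : nat -> G) (Q : nat -> nat -> {set G}), linked t v Q.

End Graphs.

Lemma embedding_weak_subdivision (G H : sgraph) (k : oedge H -> nat)
    (g : subdiv_vertex k -> G) :
    (forall e, 0 < k e) -> injective g ->
    (forall a b, subdiv_adj a b -> adj (g a) (g b)) ->
    (forall a b, adj (g a) (g b) -> subdiv_adj a b || weak_pair a b) ->
  has_induced_weak_subdivision G H.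
Proof.
move=> k0 injg g1 g2; exists (g @: [set: subdiv_vertex k]), k; split=> //.
set A := g @: _.
have exf (x : induced A) : exists a, g a == val x.
  by case: x => x /= /imsetP[a _ ->]; exists a.
pose f (x : induced A) : subdiv k := xchoose (exf x).
have fK x : g (f x) = val x by apply/eqP/(xchooseP (exf x)).
have gA a : g a \in A by apply: imset_f.
exists f; split.
- exists (fun a => exist _ (g a) (gA a)) => [x|a]; first by apply: val_inj; rewrite /= fK.
  by apply: injg; rewrite fK.
- by move=> x y /g1; rewrite !fK.
- move=> x y xy; have := g2 (f x) (f y); rewrite !fK => /(_ xy).
  by case/orP => // axy; rewrite [adj _ _]axy.
Qed.

(** The edge joining [i < j] is replaced by a shortest path through [Q i j]. Any other edge among
    the chosen vertices joins sets [Q] whose index pairs meet, which a weak subdivision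
    tolerates. *)
Lemma linked_weak_subdivision (G : sgraph) t :
  weakly_linked G t -> has_induced_weak_subdivision G (complete t).
Proof.
case=> v [Q [v_ind Q_conn Qv Q_dis]].
pose w (x : complete t) : G := v (x : 'I_t).
pose q (e : oedge (complete t)) := Q (src e : 'I_t) (tgt e : 'I_t).
have ltst (e : oedge (complete t)) : (src e : 'I_t) < (tgt e : 'I_t) < t.
  by rewrite ltn_ord andbT; have /andP[_] := valP e; rewrite !enum_rank_ord.
have vE (i j : 'I_t) : i != j -> v i != v j /\ ~~ adj (v i) (v j).
  move=> ij; case: (ltngtP i j) => lij; last by case/eqP: ij; apply: val_inj.
    by apply: v_ind; rewrite lij ltn_ord.
  by rewrite eq_sym adj_sym; apply: v_ind; rewrite lij ltn_ord.
have /fin_all_exists[s sP] (e : oedge (complete t)) :=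
  induced_connecting_path (v_ind _ _ (ltst e)).1 (v_ind _ _ (ltst e)).2
    (Qv _ _ _ (ltst e) (ltn_ord (src e : 'I_t))).1 (Qv _ _ _ (ltst e) (ltn_ord (tgt e : 'I_t))).1
    (Q_conn _ _ (ltst e)).
pose k e := size (s e).
pose g (a : subdiv_vertex k) : G := match a with
  | inl x => w x
  | inr u => nth (w (src (tag u))) (s (tag u)) (tagged u) end.
have gQ (u : side_vertex k) : g (inr u) \in q (tag u).
  by have [_ + _ _ _] := sP (tag u); apply; apply: mem_nth.
have st_neq (e : oedge (complete t)) : (src e : 'I_t) != tgt e.
  by have := ltst e; rewrite -val_eqE /=; lia.
have eq_oedge (e f : oedge (complete t)) : src e = src f -> tgt e = tgt f -> e = f.
  case: e f => -[i j] ij [[i' j'] ij'] /=; rewrite /src /tgt /= => ei ej.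
  by subst; congr exist; apply: bool_irrelevance.
have disq e f : e != f -> [disjoint q e & q f] /\
    (~~ share_endpoint e f -> forall x y, x \in q e -> y \in q f -> ~~ adj x y).
  move=> ef; have [|dis ac] := Q_dis _ _ _ _ (ltst e) (ltst f).
    apply: contra ef => /eqP[es et]; apply/eqP.
    by apply: eq_oedge; apply: val_inj.
  split=> //; rewrite negbK => nsh; apply: ac; move: nsh.
  rewrite disjoints_subset => /subsetP sub.
  have := sub (src e); have := sub (tgt e); rewrite !inE !eqxx orbT => /(_ isT) + /(_ isT).
  by rewrite !negb_or => /andP[a b] /andP[c d]; apply/and4P.
apply: (@embedding_weak_subdivision G (complete t) k g).
- by move=> e; have [] := sP e.
- move=> [x|u] [y|u'] /= E.
  + congr inl; apply/eqP; apply: contraT => /vE[]; by rewrite -/(w x) -/(w y) E eqxx.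
  + have := gQ u'; rewrite /= -E => wq.
    by have [] := Qv _ _ _ (ltst (tag u')) (ltn_ord (x : 'I_t)); rewrite -/(q _) wq.
  + have := gQ u; rewrite /= E => wq.
    by have [] := Qv _ _ _ (ltst (tag u)) (ltn_ord (y : 'I_t)); rewrite -/(q _) wq.
  + case: u u' E => [e i] [f j] E; case: (eqVneq e f) => [ef|ef].
      subst f; congr (inr (Tagged _ _)); apply: val_inj.
      by have [_ _ _ uniq_s _] := sP e; apply: uniq_s (ltn_ord i) (ltn_ord j) E.
    have [/disjointFl dis _] := disq _ _ ef.
    have := gQ (existT _ e i); rewrite [g _]E.
    by rewrite (dis _ (gQ (existT _ f j))).
- have xs (x : complete t) (u : side_vertex k) : end_adj x u -> adj (w x) (g (inr u)).
    have [_ _ _ _ [hs ht]] := sP (tag u).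
    by case/orP=> /andP[/eqP -> b] /=; rewrite ?hs ?ht.
  move=> [x|u] [y|u'] //.
  + exact: xs.
  + by move=> yu; rewrite adj_sym; apply: xs.
  + case: u u' => [e i] [f j]; rewrite /subdiv_adj /side_adj /= => /andP[/eqP ef].
    subst f => b; have [_ _ + _ _] := sP e.
    by move=> ->.
- have xs (x : complete t) (u : side_vertex k) : adj (w x) (g (inr u)) -> end_adj x u.
    rewrite /end_adj; have [_ _ _ _ [hs ht]] := sP (tag u).
    case: (eqVneq x (src (tag u))) => [-> /=|nx].
      by rewrite hs // => ->.
    case: (eqVneq x (tgt (tag u))) => [-> /=|ny].
      by rewrite ht.
    have [_ +] := Qv _ _ _ (ltst (tag u)) (ltn_ord (x : 'I_t)).
    by move=> /(_ nx ny _ (gQ u)) /negbTE; rewrite /w => ->.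
  move=> [x|u] [y|u'].
  + rewrite /= => xy; case: (eqVneq x y) xy => [->|/vE[_]]; first by rewrite adj_irr.
    by rewrite -/(w x) -/(w y) => /negbTE ->.
  + by move=> /xs /= ->.
  + by rewrite adj_sym => /xs /= ->.
  + rewrite /= /side_adj; case: u u' => [e i] [f j] /=.
    case: (eqVneq e f) => [ef|ef] /=.
      subst f; have [_ _ + _ _] := sP e => -> //.
      by rewrite orbF.
    move=> a; apply: contraT => nsh; have [_ ac] := disq _ _ ef.
    by have := ac nsh _ _ (gQ (existT _ e i)) (gQ (existT _ f j)); rewrite /= a.
Qed.

(** * Coherent graphs *)

Section Coherence.
Variables (G : sgraph) (m : nat).
Implicit Types (x y z : G) (A B C D F S U X Y Z : {set G}).

Lemma disjointI A B :
  (forall x, x \in A -> x \in B -> False) -> [disjoint A & B].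
Proof.
by move=> h; apply/pred0P => x /=; apply/negbTE/negP => /andP[/h].
Qed.

(** After trimming the sets to size [m], this says that the complement has no bi-clique of size
    [m]. *)
Definition coherent := forall A B, [disjoint A & B] -> m <= #|A| -> m <= #|B| ->
  exists a b, [/\ a \in A, b \in B & adj a b].

(** Applied twice to a subset of [Z], it gives the ball of radius two measured inside [Z]: the
    intermediate vertex must lie in [Z] as well. *)
Definition clnb Z A : {set G} := [set y in Z | [exists x in A, touch x y]].

Lemma clnbP Z A y :
  reflect (y \in Z /\ exists2 x, x \in A & touch x y) (y \in clnb Z A).
Proof.
rewrite inE; apply: (iffP andP) => -[yZ].
  by case/exists_inP => x xA xy; split=> //; exists x.
by case=> x xA xy; split=> //; apply/exists_inP; exists x.
Qed.

Lemma clnb_sub Z A : clnb Z A \subset Z.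
Proof. by apply/subsetP => y /clnbP[]. Qed.

Lemma clnb_ext Z A : A \subset Z -> A \subset clnb Z A.
Proof.
move=> /subsetP sAZ; apply/subsetP => x xA; apply/clnbP; split; first exact: sAZ.
by exists x; rewrite // /touch eqxx.
Qed.

Lemma clnbS Z A B : A \subset B -> clnb Z A \subset clnb Z B.
Proof.
move=> /subsetP sAB; apply/subsetP => y /clnbP[yZ [x xA xy]].
by apply/clnbP; split=> //; exists x; rewrite ?sAB.
Qed.

Lemma clnbU Z A B : clnb Z (A :|: B) = clnb Z A :|: clnb Z B.
Proof.
apply/setP => y; apply/idP/setUP => [/clnbP[yZ [x /setUP[xA|xB] xy]]|].
- by left; apply/clnbP; split=> //; exists x.
- by right; apply/clnbP; split=> //; exists x.
by case; apply: subsetP; apply: clnbS; rewrite ?subsetUl ?subsetUr.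
Qed.

Lemma clnb1 Z x : clnb Z [set x] = [set y in Z | touch x y].
Proof.
apply/setP => y; rewrite [RHS]inE; apply/clnbP/andP => -[yZ].
  by case=> z /set1P ->.
by move=> xy; split=> //; exists x; rewrite ?set11.
Qed.

Lemma touch_clnb1 Z x y : y \in Z -> touch x y -> y \in clnb Z [set x].
Proof. by move=> yZ xy; rewrite clnb1 inE yZ. Qed.

Lemma clnb_trans Z A x y : x \in clnb Z A -> y \in Z -> touch x y ->
  y \in clnb Z (clnb Z A).
Proof. by move=> xA yZ xy; apply/clnbP; split=> //; exists x. Qed.

Lemma subset_of_size n A : n <= #|A| -> exists2 B : {set G}, B \subset A & #|B| = n.
Proof.
move=> nA; exists [set x in take n (enum A)].
  by apply/subsetP => x; rewrite inE => /mem_take; rewrite mem_enum.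
rewrite cardsE (card_uniqP _) ?take_uniq ?enum_uniq // size_takel //.
by rewrite -cardE.
Qed.

Hypothesis coh : coherent.

(** Possible overlap costs a factor of two: [m] vertices of [A] are set aside and removed from [B],
    which keeps at least [m]. *)
Lemma coherent_edge A B : 2 * m <= #|A| -> 2 * m <= #|B| ->
  exists a b, [/\ a \in A, b \in B & adj a b].
Proof.
move=> mA mB; have [|A' sA cA] := @subset_of_size m A; first lia.
have dis : [disjoint A' & B :\: A'].
  by apply: disjointI => x xA; rewrite inE xA.
have [||a [b [aA /setDP[bB _] ab]]] := coh dis; first by rewrite cA.
  by have := cardsID A' B; have := subset_leq_card (subsetIr B A'); lia.
by exists a, b; rewrite (subsetP sA).
Qed.

Lemma card_undominated Z D : m <= #|D| -> #|Z :\: clnb Z D| < m.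
Proof.
move=> mD; rewrite ltnNge; apply/negP => mB.
have [|a [b [aD /setDP[bZ /negP nb] ab]]] := @coh D (Z :\: clnb Z D) _ mD mB.
  apply: disjointI => x xD /setDP[xZ /negP[]]; apply/clnbP; split=> //.
  by exists x; rewrite // /touch eqxx.
by apply: nb; apply/clnbP; split=> //; exists a; rewrite // /touch ab orbT.
Qed.

(** A first neighbourhood of [m] vertices dominates all but fewer than [m] vertices of [Z]. Used to
    show that a set with a small second neighbourhood has a tiny first one. *)
Lemma card_clnb2 Z A : m <= #|clnb Z A| -> #|Z| < #|clnb Z (clnb Z A)| + m.
Proof.
move=> /(@card_undominated Z) ; set B := clnb Z (clnb Z A).
have /setIidPr E : B \subset Z by apply: clnb_sub.
by rewrite -(cardsID B Z) E; lia.
Qed.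

Definition connected D := forall x y, x \in D -> y \in D -> connect (radj D) x y.

(** Take a smallest union of components missing fewer than [m] vertices of [U]. If it were
    disconnected, it would split into two closed parts, both smaller than [m] by minimality and
    coherence, and [U] would have fewer than [3 * m] vertices. *)
Lemma giant_component U : 3 * m <= #|U| ->
  exists D, [/\ D \subset U, connected D & #|U :\: D| < m].
Proof.
(* For [m = 0] coherence is contradictory, as two empty sets show. *)
move=> mU; case: (posnP m) => [m0|m_gt0].
  have [|||x [y [xA xB _]]] := @coh set0 set0; rewrite ?m0 ?disjoints_subset ?sub0set //.
  by rewrite inE in xA.
pose cl X := [forall x in X, forall y in U :\: X, ~~ adj x y].
pose P X := [&& X \subset U, cl X & #|U :\: X| < m].
have PU : P U.
  rewrite /P subxx setDv cards0 m_gt0 andbT; apply/forall_inP => x _.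
  by apply/forall_inP => y; rewrite setDv inE.
case: (arg_minnP (fun X => #|X|) PU) => X /and3P[sXU clX cX] minX.
have clXP x y : x \in X -> y \in U -> adj x y -> y \in X.
  move=> xX yU xy; apply: contraT => yX.
  by have /forall_inP/(_ x xX)/forall_inP/(_ y) := clX; rewrite inE yX yU xy => /(_ isT).
exists X; split=> // x y xX yX.
pose C := [set z in X | connect (radj X) x z].
have sCX : C \subset X by apply/subsetP => z; rewrite inE => /andP[].
suff: C = X by move=> CX; move: yX; rewrite -{1}CX inE => /andP[].
apply/eqP; rewrite eqEsubset sCX /=; apply: contraT => /subsetPn[z zX zC].
have xC : x \in C by rewrite inE xX connect0.
have closedC a b : a \in C -> b \in X -> adj a b -> b \in C.
  rewrite !inE => /andP[aX xa] bX ab; rewrite bX; apply: connect_trans xa _.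
  by apply: connect1; rewrite /radj /= aX bX.
have clC : cl C.
  apply/forall_inP => a aC; apply/forall_inP => b /setDP[bU bC].
  apply: contra bC => ab; apply: (closedC a) => //.
  by apply: (clXP a) => //; rewrite (subsetP sCX).
have clXC : cl (X :\: C).
  apply/forall_inP => a /setDP[aX aC]; apply/forall_inP => b /setDP[bU bXC].
  apply/negP => ab; have bX : b \in X by apply: clXP ab.
  case/negP: aC; apply: (closedC b) => //; last by rewrite adj_sym.
  by move: bXC; rewrite inE bX andbT negbK.
have sCU := subset_trans sCX sXU.
have sXCU : X :\: C \subset U by apply: subset_trans sXU; apply: subsetDl.
(* By minimality a smaller closed [Y] misses at least [m] vertices; if it also had [m] vertices,
   coherence would give an edge leaving it. *)
have cc Y : Y \subset U -> cl Y -> #|Y| < #|X| -> #|Y| < m.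
  move=> sYU clY ltYX; rewrite ltnNge; apply/negP => mY.
  have mUY : m <= #|U :\: Y|.
    rewrite leqNgt; apply/negP => h; have := minX Y.
    by rewrite /P sYU clY h => /(_ isT); rewrite leqNgt ltYX.
  have [|a [b [aY bUY ab]]] := @coh Y (U :\: Y) _ mY mUY.
    by apply: disjointI => u uY; rewrite inE uY.
  by have /forall_inP/(_ a aY)/forall_inP/(_ b bUY) := clY; rewrite ab.
have eqX : #|C| + #|X :\: C| = #|X|.
  by have /setIidPr E := sCX; rewrite -[in RHS](cardsID C X) E.
have C_gt0 : 0 < #|C| by rewrite card_gt0; apply/set0Pn; exists x.
have XC_gt0 : 0 < #|X :\: C| by rewrite card_gt0; apply/set0Pn; exists z; rewrite inE zC.
have h1 := cc C sCU clC; have h2 := cc _ sXCU clXC.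
have eqU : #|X| + #|U :\: X| = #|U|.
  by have /setIidPr E := sXU; rewrite -[in RHS](cardsID X U) E.
by exfalso; clear -eqX C_gt0 XC_gt0 h1 h2 eqU mU cX; lia.
Qed.

Definition sep X Y := [forall x in X, forall y in Y, ~~ touch x y].

Lemma sepC X Y : sep X Y = sep Y X.
Proof.
apply/idP/idP => /forall_inP h; apply/forall_inP => x xX; apply/forall_inP => y yY;
  by rewrite touch_sym; have /forall_inP := h _ yY; apply.
Qed.

Lemma sepP X Y x y : sep X Y -> x \in X -> y \in Y -> ~~ touch x y.
Proof. by move=> /forall_inP h xX yY; have /forall_inP := h _ xX; apply. Qed.

Lemma sep_disjoint X Y : sep X Y -> [disjoint X & Y].
Proof.
move=> h; apply: disjointI => x xX xY; have := sepP h xX xY.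
by rewrite /touch eqxx.
Qed.

(** Routes at one branch vertex belong to edges of [K_t] sharing an endpoint, between whose
    side-vertices a weak subdivision tolerates edges; routes at different branch vertices are kept
    fully apart. *)
Definition compatible (i j : nat) X Y := if i == j then [disjoint X & Y] else sep X Y.

Lemma compatibleC i j X Y : compatible i j X Y = compatible j i Y X.
Proof. by rewrite /compatible eq_sym disjoint_sym sepC. Qed.

Lemma compatible_disjoint i j X Y : compatible i j X Y -> [disjoint X & Y].
Proof. by rewrite /compatible; case: eqP => // _ /sep_disjoint. Qed.

Definition arms_of (s : seq (nat * nat)) : seq (nat * nat) :=
  s ++ [seq (p.2, p.1) | p <- s].

(* A route of the arm [(i, a)] starts at the branch vertex [v i] and ends at a
   vertex [c] of [T i a]; the arms [(i, j)] and [(j, i)] are joined by an edge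
   between the ends of their routes. *)
Lemma weakly_linked_of_routes t b (v : nat -> G) (T : nat -> nat -> {set G})
    (R : nat -> nat -> G -> {set G}) :
    (forall i j, i < j < t -> v i != v j /\ ~~ adj (v i) (v j)) ->
    (forall i a c, i < t -> a < t -> c \in T i a ->
      [/\ connect (radj (v i |: R i a c)) (v i) c, c \in R i a c,
          forall k, k < t -> v k \notin R i a c &
          forall k x, k < t -> k != i -> x \in R i a c -> ~~ adj (v k) x]) ->
    (forall i a j a' c, i < t -> a < t -> j < t -> a' < t -> (i, a) != (j, a') ->
      c \in T i a ->
      #|[set c' in T j a' | ~~ compatible i j (R i a c) (R j a' c')]| <= b) ->
    (forall i a, i < t -> a < t -> 2 * m + 2 * t ^ 2 * b <= #|T i a|) ->
  weakly_linked G t.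
Proof.
move=> v_ind T_route T_comp T_size.
(* The ends are chosen pair by pair. The two arms of one pair are exempt from compatibility because
   their ends are to be joined. *)
pose ok (s : seq (nat * nat)) (c : nat -> nat -> G) :=
  (forall i j : nat, (i, j) \in s ->
     [/\ c i j \in T i j, c j i \in T j i & adj (c i j) (c j i)]) /\
  (forall i a j a' : nat, (i, a) \in arms_of s -> (j, a') \in arms_of s ->
     (i, a) != (j, a') -> (i, a) != (a', j) ->
     compatible i j (R i a (c i a)) (R j a' (c j a'))).
have exok (s : seq (nat * nat)) : uniq s ->
    (forall p : nat * nat, p \in s -> p.1 < p.2 < t) -> size s <= t ^ 2 ->
    exists c, ok s c.
  elim: s => [|[i j] s IHs] /=; first by move=> _ _ _; exists (fun _ _ => v 0).
  case/andP=> ijs us lts szs.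
  have [||c [c1 c2]] := IHs us.
  - by move=> p ps; apply: lts; rewrite inE ps orbT.
  - exact: ltnW.
  have := lts (i, j); rewrite inE eqxx /= => /(_ isT) ij.
  have lts' (x y : nat) : (x, y) \in s -> x < y < t.
    by move=> h; have := lts (x, y); rewrite inE h orbT; apply.
  have uls (i' a' : nat) : (i', a') \in arms_of s -> i' < t /\ a' < t.
    rewrite mem_cat => /orP[h|/mapP[[x y] h [-> ->]]];
      by have := lts' _ _ h; clear; lia.
  have cT (i' a' : nat) : (i', a') \in arms_of s -> c i' a' \in T i' a'.
    rewrite mem_cat => /orP[h|/mapP[[x y] h [-> ->]]]; first by have [] := c1 _ _ h.
    by have [] := c1 _ _ h.
  (* At most [2 * t ^ 2] arms are fixed so far and each spoils at most [b] ends; the [2 * m] ends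
     left on either side let coherence supply an edge. *)
  have good (i0 j0 : nat) : i0 < t -> j0 < t -> (i0, j0) \notin arms_of s ->
     2 * m <= #|[set c' in T i0 j0 | all (fun u => compatible u.1 i0
         (R u.1 u.2 (c u.1 u.2)) (R i0 j0 c')) (arms_of s)]|.
    move=> i0t j0t nu; set X := [set c' in _ | _].
    have bad_le (r : seq (nat * nat)) : {subset r <= arms_of s} ->
      #|[set c' in T i0 j0 | ~~ all (fun u => compatible u.1 i0
         (R u.1 u.2 (c u.1 u.2)) (R i0 j0 c')) r]| <= size r * b.
      elim: r => [|[x y] r IHr] sr.
        by rewrite leqn0 cards_eq0; apply/eqP/setP => z; rewrite !inE /= andbF.
      have xyu : (x, y) \in arms_of s by apply: sr; rewrite inE eqxx.
      have [xt yt] := uls _ _ xyu.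
      have h := T_comp x y i0 j0 (c x y) xt yt i0t j0t _ (cT _ _ xyu).
      rewrite mulSn; apply: leq_trans (leq_add (h _) (IHr _)); last 2 first.
      - by apply: contra nu => /eqP <-.
      - by move=> u ur; apply: sr; rewrite inE ur orbT.
      apply: leq_trans (leq_card_setU _ _); apply/subset_leq_card/subsetP => z.
      by rewrite !inE /= negb_and => /andP[-> ].
    have := bad_le _ (fun u h => h); rewrite size_cat size_map => hb.
    have := T_size i0 j0 i0t j0t.
    have -> : #|T i0 j0| = #|X| + #|T i0 j0 :\: X|.
      have /setIidPr E : X \subset T i0 j0 by apply/subsetP => z; rewrite inE => /andP[].
      by rewrite -[in LHS](cardsID X) E.
    have : #|T i0 j0 :\: X| <= (size s + size s) * b.
      apply: leq_trans hb; apply/subset_leq_card/subsetP => z.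
      by rewrite !inE => /andP[+ zT]; rewrite zT /=.
    have : (size s + size s) * b <= 2 * t ^ 2 * b by rewrite leq_mul2r; clear -szs; lia.
    by clear; lia.
  have nu (x y : nat) : (x, y) != (i, j) -> (x, y) != (j, i) ->
     (x, y) \in arms_of ((i, j) :: s) -> (x, y) \in arms_of s.
    by rewrite /arms_of !mem_cat !inE /= => /negbTE -> /negbTE ->.
  have nij : (i, j) \notin arms_of s.
    rewrite mem_cat (negbTE ijs) /=; apply/mapP => -[[x y] h [ei ej]].
    by have := lts' _ _ h; rewrite -ei -ej; clear -ij; lia.
  have nji : (j, i) \notin arms_of s.
    rewrite mem_cat; apply/negP => /orP[h|/mapP[[x y] h [ej ei]]].
      by have := lts' _ _ h; clear -ij; lia.
    by rewrite ei ej h in ijs.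
  have it : i < t by clear -ij; lia.
  have jt : j < t by clear -ij; lia.
  have [c' [c'' [c'X c''X cc]]] := coherent_edge (good i j it jt nij) (good j i jt it nji).
  move: c'X c''X; rewrite !inE => /andP[c'T /allP c'ok] /andP[c''T /allP c''ok].
  pose d (x y : nat) := if (x, y) == (i, j) then c' else if (x, y) == (j, i) then c'' else c x y.
  have dij : d i j = c' by rewrite /d eqxx.
  have dji : d j i = c''.
    by rewrite /d eqxx; case: eqP => // -[e _]; rewrite e ltnn in ij.
  have dE (x y : nat) : (x, y) \in arms_of s -> d x y = c x y.
    move=> xyu; rewrite /d; case: eqP => [e|_]; first by rewrite e (negbTE nij) in xyu.
    by case: eqP => // e; rewrite e (negbTE nji) in xyu.
  exists d; split=> [x y|x y x' y' xyu xyu' ne1 ne2].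
    rewrite inE => /orP[/eqP[-> ->]|h]; first by rewrite dij dji.
    rewrite !dE; first exact: c1.
      by rewrite mem_cat; apply/orP; right; apply/mapP; exists (x, y).
    by rewrite mem_cat h.
  have newold (z w x0 y0 : nat) : (z, w) = (i, j) \/ (z, w) = (j, i) -> (x0, y0) \in arms_of s ->
      compatible x0 z (R x0 y0 (d x0 y0)) (R z w (d z w)).
    move=> [] [-> ->] h; rewrite (dE _ _ h) ?dij ?dji.
      exact: (c'ok (x0, y0)).
    exact: (c''ok (x0, y0)).
  have dec (z w : nat) : (z, w) \in arms_of ((i, j) :: s) ->
     ((z, w) = (i, j) \/ (z, w) = (j, i)) \/ (z, w) \in arms_of s.
    move=> h; case: (eqVneq (z, w) (i, j)) => [->|n1]; first by left; left.
    case: (eqVneq (z, w) (j, i)) => [->|n2]; first by left; right.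
    by right; apply: nu.
  case: (dec _ _ xyu) => [n|o]; case: (dec _ _ xyu') => [n'|o'].
  - exfalso; case: n n' ne1 ne2 => [] [-> ->] [] [-> ->]; by rewrite !eqxx.
  - by rewrite compatibleC; apply: newold.
  - exact: newold.
  - by rewrite !dE //; apply: c2.
pose s := [seq p <- [seq (i, j) | i <- iota 0 t, j <- iota 0 t] | p.1 < p.2].
have [||| c [c1 c2]] := exok s.
- apply: filter_uniq; apply: allpairs_uniq; rewrite ?iota_uniq //.
  by move=> [? ?] [? ?] _ _ [-> ->].
- move=> [i j]; rewrite mem_filter => /andP[/= ij /allpairsP[[x y] /= [_ yt [_ ej]]]].
  by move: yt; rewrite mem_iota add0n -ej /= ij.
- apply: leq_trans (leq_trans (count_size _ _) _); first by rewrite size_filter.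
  by rewrite size_allpairs size_iota.
have ins (i j : nat) : i < j < t -> (i, j) \in s.
  move=> ij; rewrite mem_filter /=; apply/andP; split; first lia.
  by apply/allpairsP; exists (i, j); rewrite !mem_iota /=; split=> //; lia.
have inu (i j : nat) : i < t -> j < t -> i != j -> (i, j) \in arms_of s.
  move=> it jt ij; rewrite mem_cat; case: (ltngtP i j) => lij; last by rewrite lij eqxx in ij.
    by rewrite ins // lij.
  apply/orP; right; apply/mapP; exists (j, i) => //; apply: ins; clear -it jt lij; lia.
have inT (i j : nat) : i < t -> j < t -> i != j -> c i j \in T i j.
  move=> it jt ij; case: (ltngtP i j) => lij; last by rewrite lij eqxx in ij.
    by have [|] := c1 i j; first by apply: ins; clear -it jt lij; lia.
  by have [|] := c1 j i; first by apply: ins; clear -it jt lij; lia.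
exists v, (fun i j => R i j (c i j) :|: R j i (c j i)); split=> //.
- move=> i j ij; have it : i < t by clear -ij; lia.
  have jt : j < t by clear -ij; lia.
  have neij : i != j by clear -ij; lia.
  have neji : j != i by clear -ij; lia.
  have [con1 cR1 _ _] := T_route _ _ _ it jt (inT _ _ it jt neij).
  have [con2 cR2 _ _] := T_route _ _ _ jt it (inT _ _ jt it neji).
  have [_ _ ec] := c1 _ _ (ins _ _ ij).
  apply: connect_trans (connect_radjS _ con1) _.
    by apply: setUS; apply: subset_trans (subsetUr _ _); apply: subsetUl.
  apply: (@connect_trans _ _ (c j i)).
    by apply: connect1; rewrite /radj /= !inE cR1 cR2 ec !orbT.
  rewrite connect_radjC; apply: connect_radjS con2.
  by apply: subset_trans (subsetUr _ _); apply: setUS; apply: subsetUr.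
- move=> i j k ij kt; have it : i < t by clear -ij; lia.
  have jt : j < t by clear -ij; lia.
  have neij : i != j by clear -ij; lia.
  have neji : j != i by clear -ij; lia.
  have [_ _ r1 r2] := T_route _ _ _ it jt (inT _ _ it jt neij).
  have [_ _ r3 r4] := T_route _ _ _ jt it (inT _ _ jt it neji).
  split; first by rewrite inE negb_or r1 ?r3.
  by move=> ki kj x /setUP[|]; [apply: r2 | apply: r4].
- move=> i j k l ij kl ne; have it : i < t by clear -ij; lia.
  have jt : j < t by clear -ij; lia.
  have kt : k < t by clear -kl; lia.
  have lt : l < t by clear -kl; lia.
  have neij : i != j by clear -ij; lia.
  have neji : j != i by clear -ij; lia.
  have nekl : k != l by clear -kl; lia.
  have nelk : l != k by clear -kl; lia.
  have ne2 : (i, j) != (l, k) by apply/eqP => -[e1 e2]; clear -ij kl e1 e2; lia.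
  have ne3 : (j, i) != (k, l) by apply/eqP => -[e1 e2]; clear -ij kl e1 e2; lia.
  have ne4 : (j, i) != (l, k) by apply: contra ne => /eqP[-> ->].
  have q1 := c2 _ _ _ _ (inu _ _ it jt neij) (inu _ _ kt lt nekl) ne ne2.
  have q2 := c2 _ _ _ _ (inu _ _ it jt neij) (inu _ _ lt kt nelk) ne2 ne.
  have q3 := c2 _ _ _ _ (inu _ _ jt it neji) (inu _ _ kt lt nekl) ne3 ne4.
  have q4 := c2 _ _ _ _ (inu _ _ jt it neji) (inu _ _ lt kt nelk) ne4 ne3.
  split.
    have dd X Y u p q : compatible p q X Y -> u \in X -> u \in Y -> False.
      by move=> /compatible_disjoint/disjointFr h uX; rewrite h.
    apply: disjointI => x /setUP[xi|xj] /setUP[yk|yl].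
    - exact: dd q1 xi yk.
    - exact: dd q2 xi yl.
    - exact: dd q3 xj yk.
    - exact: dd q4 xj yl.
  case/and4P=> /negbTE ik /negbTE il /negbTE jk /negbTE jl x y.
  move: q1 q2 q3 q4; rewrite /compatible ik il jk jl => q1 q2 q3 q4.
  have na X Y u w : sep X Y -> u \in X -> w \in Y -> ~~ adj u w.
    by move=> h uX wY; have := sepP h uX wY; rewrite negb_or => /andP[].
  by move=> /setUP[xi|xj] /setUP[yk|yl]; [apply: na q1 _ _|apply: na q2 _ _|
    apply: na q3 _ _|apply: na q4 _ _].
Qed.

End Coherence.

(** * Small balls of radius two *)

Section SmallBalls.
Variable G : sgraph.
Implicit Types (x y z : G) (A B C D F S U X Y Z : {set G}).

Lemma disjoint_family U n w : n * w <= #|U| ->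
  exists P : nat -> {set G},
    (forall a, a < n -> P a \subset U /\ #|P a| = w) /\
    (forall a b, a < n -> b < n -> a != b -> [disjoint P a & P b]).
Proof.
elim: n U => [|n IHn] U; first by exists (fun _ => set0).
rewrite mulSn => leU; have [|B sBU cB] := @subset_of_size G w U.
  by apply: leq_trans leU; apply: leq_addr.
have [|P [P1 P2]] := IHn (U :\: B).
  by have := cardsID B U; have /setIidPr -> := sBU; lia.
have dB a : a < n -> [disjoint P a & B].
  move=> /P1[/subsetP sP _]; apply: disjointI => x /sP.
  by rewrite inE => /andP[/negP].
exists (fun a => if a == n then B else P a); split=> [a|a b].
  case: eqP => [_|ne] // lea; have [|] := P1 a; first lia.
  by move=> sP ->; split=> //; apply: subset_trans sP _; apply: subsetDl.
case: (eqVneq a n) => [->|an]; case: (eqVneq b n) => [->|bn] // lea leb ne.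
- by rewrite disjoint_sym dB //; lia.
- by rewrite dB //; lia.
- by apply: P2 => //; lia.
Qed.

Lemma card_bigcup_le n (A : 'I_n -> {set G}) c :
  (forall i, #|A i| <= c) -> #|\bigcup_i A i| <= n * c.
Proof.
move=> leA; have: #|\bigcup_i A i| <= \sum_i #|A i|.
  apply: (big_ind2 (fun (X : {set G}) k => #|X| <= k)) => //.
    by rewrite cards0.
  by move=> X k Y l hX hY; apply: leq_trans (leq_card_setU _ _) (leq_add hX hY).
move/leq_trans; apply; apply: leq_trans (leq_sum _ (fun i _ => leA i)) _.
by rewrite sum_nat_const card_ord.
Qed.

Lemma clnb_bigcup Z n (A : 'I_n -> {set G}) :
  clnb Z (\bigcup_i A i) = \bigcup_i clnb Z (A i).
Proof.
apply: (big_morph (clnb Z)) => [X Y|]; first exact: clnbU.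
by apply/setP => y; rewrite [RHS]inE; apply/negbTE/negP => /clnbP[_ [x]]; rewrite inE.
Qed.

(** Adding one vertex enlarges the second neighbourhood by at most [q]. So extend a maximum
    connected set that contains [s] and stays below [h] by one adjacent vertex: it must reach [h]
    without exceeding [h + q]. *)
Lemma grow_core Z D s h q :
    connected D -> D \subset Z -> s \in D ->
    (forall x, x \in Z -> #|clnb Z (clnb Z [set x])| <= q) ->
    h <= #|clnb Z (clnb Z D)| ->
  exists F : {set G}, [/\ F \subset D, s \in F, forall x, x \in F -> connect (radj F) s x,
    h <= #|clnb Z (clnb Z F)| & #|clnb Z (clnb Z F)| <= h + q].
Proof.
move=> cD sDZ sD ballq hD.
case: (leqP h #|clnb Z (clnb Z [set s])|) => [hs|hs].
  exists [set s]; split; rewrite ?sub1set ?set11 //.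
    by move=> x /set1P ->.
  by apply: leq_trans (leq_addl _ _); apply: ballq; apply: (subsetP sDZ).
pose P F := [&& F \subset D, s \in F, [forall x in F, connect (radj F) s x] &
  #|clnb Z (clnb Z F)| < h].
have P1 : P [set s].
  rewrite /P sub1set sD set11 hs andbT; apply/forall_inP => x /set1P ->.
  exact: connect0.
case: (arg_maxnP (fun F => #|F|) P1) => F /and4P[sFD sF /forall_inP cF hF] maxF.
have [x xD xF] : exists2 x, x \in D & x \notin F.
  apply/subsetPn; apply/negP => sDF.
  have E : F = D by apply/eqP; rewrite eqEsubset sFD.
  by rewrite E in hF; move: hF; rewrite ltnNge hD.
have [u [y [uF yF /and3P[uD yD uy]]]] := connect_crossing (cD _ _ sD xD) sF xF.
have cFy z : z \in y |: F -> connect (radj (y |: F)) s z.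
  have up w : w \in F -> connect (radj (y |: F)) s w.
    by move=> /cF; apply: connect_radjS; apply: subsetUr.
  case/setU1P => [->|/up //]; apply: connect_trans (up _ uF) _.
  by apply: connect1; rewrite /radj /= !inE uF eqxx uy orbT.
exists (y |: F); split=> //.
- by rewrite subUset sub1set yD.
- by rewrite inE sF orbT.
- rewrite leqNgt; apply/negP => lth; have := maxF (y |: F).
  have PF : P (y |: F).
    apply/and4P; split=> //; last by apply/forall_inP.
      by rewrite subUset sub1set yD.
    by rewrite inE sF orbT.
  by move=> /(_ PF); rewrite cardsU1 yF add1n /= ltnn.
rewrite !clnbU addnC; apply: leq_trans (leq_card_setU _ _) (leq_add _ (ltnW hF)).
by apply: ballq; apply: (subsetP sDZ).
Qed.

End SmallBalls.

(* Arms are connected cores [F] whose second neighbourhood has size about [h]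
   although each single vertex has a second neighbourhood of size at most [q],
   much smaller than [h]; by coherence the first neighbourhood of [F] is then
   smaller than [m]. *)
Lemma small_balls_weakly_linked t : 0 < t -> exists E, forall (G : sgraph) m (Z : {set G}),
    0 < m -> coherent G m -> E * m <= #|Z| ->
    (forall x, x \in Z -> E * #|clnb Z (clnb Z [set x])| <= #|Z|) ->
  weakly_linked G t.
Proof.
move=> t0; exists (1000 * t ^ 4) => G m Z m0 coh mZ ballE.
(* [q] bounds both [m] and the balls of radius two; [h] is the size to which second neighbourhoods
   of cores are grown. It is at least [62 * t ^ 2 * q], while [t ^ 2 * h] is at most a sixteenth of
   [N]. *)
set N := #|Z|; pose q := N %/ (1000 * t ^ 4); pose h := N %/ (16 * t ^ 2).
have E0 : 0 < 1000 * t ^ 4 by rewrite muln_gt0 expn_gt0 t0.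
have H0 : 0 < 16 * t ^ 2 by rewrite muln_gt0 expn_gt0 t0.
have mq : m <= q by rewrite leq_divRL // mulnC.
have ballq x : x \in Z -> #|clnb Z (clnb Z [set x])| <= q.
  by move=> /ballE; rewrite leq_divRL // mulnC.
have qN : 1000 * (t ^ 2 * (t ^ 2 * q)) <= N.
  by rewrite (mulnA (t ^ 2)) -expnD mulnA mulnC; apply: leq_divM.
have hN : 16 * (t ^ 2 * h) <= N.
  by rewrite mulnA mulnC; apply: leq_divM.
have qh : 62 * (t ^ 2 * q) <= h.
  rewrite leq_divRL //; apply: leq_trans qN; clear; set a := t ^ 2.
  by rewrite mulnACA [_ * a]mulnC leq_mul.
have tt : t <= t ^ 2 by rewrite -{1}(expn1 t) leq_pexp2l.
have qt : q <= t * q by rewrite leq_pmull.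
have tq2 : t * q <= t ^ 2 * q by rewrite leq_mul2r tt orbT.
have h2 : h <= t ^ 2 * h by rewrite leq_pmull // expn_gt0 t0.
pose N2 A := clnb Z (clnb Z A).
pose K (v : nat -> G) (F : nat -> nat -> {set G}) i := v i |: \bigcup_(a < t) F i a.
pose arm (v : nat -> G) (F : nat -> nat -> {set G}) i a :=
  [/\ F i a \subset Z, exists2 s, s \in F i a & adj (v i) s /\
      (forall x, x \in F i a -> connect (radj (F i a)) s x),
      h <= #|N2 (F i a)|, #|N2 (F i a)| <= h + q & v i \notin F i a].
(* The last clause keeps different branch vertices, together with their cores, at distance at least
   three inside [Z]. *)
pose good n (v : nat -> G) F := [/\ forall i, i < n -> v i \in Z,
  forall i a, i < n -> a < t -> arm v F i a,
  forall i a b, i < n -> a < t -> b < t -> a != b -> [disjoint F i a & F i b] &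
  forall i k, k < i -> i < n -> [disjoint K v F i & N2 (K v F k)]].
have cardN2K n v F i : good n v F -> i < n -> #|N2 (K v F i)| <= q + t * (h + q).
  case=> vZ hF _ _ lin; rewrite /N2 /K !clnbU !clnb_bigcup.
  apply: leq_trans (leq_card_setU _ _) (leq_add (ballq _ (vZ _ lin)) _).
  by apply: card_bigcup_le => a; have [] := hF i a lin (ltn_ord a).
have [z0 z0Z] : exists z0, z0 \in Z by apply/set0Pn; rewrite -card_gt0 -/N; nia.
have ex_good n : n <= t -> exists v F, good n v F.
  elim: n => [|n IHn] ltn; first by exists (fun _ => z0), (fun _ _ => set0); split.
  have [v [F gvF]] := IHn (ltnW ltn); have [vZ hF disF farF] := gvF.
  pose X := \bigcup_(k < n) N2 (K v F k).
  have cX : #|X| <= n * (q + t * (h + q)).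
    by apply: card_bigcup_le => k; apply: (cardN2K n).
  have cU : (t.+1) * (3 * (t * q)) <= #|Z :\: X|.
    have : #|Z :&: X| <= #|X| by apply/subset_leq_card/subsetIr.
    have := cardsID X Z; rewrite -/N => eN le1.
    have le2 : n * (q + t * (h + q)) <= t * (q + t * (h + q)) by rewrite leq_mul2r (ltnW ltn) orbT.
    have e3 : t * (q + t * (h + q)) = t * q + t ^ 2 * h + t ^ 2 * q by clear; nia.
    have e4 : t.+1 * (3 * (t * q)) = 3 * (t ^ 2 * q) + 3 * (t * q) by clear; nia.
    have e5 : t ^ 2 * q <= t ^ 2 * (t ^ 2 * q) by rewrite leq_pmull // expn_gt0 t0.
    clear -eN le1 le2 e3 e4 e5 cX qN hN tq2.
    by rewrite e4; rewrite e3 in le2; lia.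
  (* The first [t] pieces will hold the cores of the new branch vertex, piece [t] the vertex
     itself. *)
  have [P [P1 P2]] := disjoint_family cU.
  have Pa a : a < t -> exists D : {set G}, [/\ D \subset P a, connected D & m <= #|D|].
    move=> at_; have [sP cP] := P1 a (leqW at_).
    have [|D [sD cD mD]] := @giant_component G m coh (P a).
      by rewrite cP leq_mul2l; apply: leq_trans mq qt.
    exists D; split=> //; have := cardsID D (P a); have /setIidPr -> := sD.
    by rewrite cP; clear -mD mq qt; lia.
  have /fin_all_exists[D DP] (a : 'I_t) := Pa a (ltn_ord a).
  have [sPt cPt] := P1 t (leqnn _).
  (* Each [D a] fails to touch fewer than [m] vertices of piece [t]; together they miss at most
     [t * m] of its [3 * (t * q)] vertices. *)
  have [w wPt wD] : exists2 w, w \in P t & forall a : 'I_t, w \in clnb (P t) (D a).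
    pose Y := \bigcup_(a < t) (P t :\: clnb (P t) (D a)).
    have cY : #|Y| <= t * m.
      apply: card_bigcup_le => a; apply: ltnW; apply: card_undominated => //.
      by have [] := DP a.
    have /subsetPn[w wP wY] : ~~ (P t \subset Y).
      apply/negP => /subset_leq_card; rewrite cPt.
      have : t * m <= t * q by rewrite leq_mul2l mq orbT.
      have : 0 < t * q by rewrite muln_gt0 t0 (leq_trans m0 mq).
      by clear -cY; lia.
    exists w => // a; apply: contraR wY => nw.
    by apply/bigcupP; exists a; rewrite // inE nw.
  have wUX : w \in Z :\: X by apply: (subsetP sPt).
  have wZ : w \in Z by case/setDP: wUX.
  have PZ a : a < t.+1 -> P a \subset Z.
    by move=> /P1[sP _]; apply: subset_trans sP _; apply: subsetDl.
  have coreP (a : 'I_t) : exists F' : {set G}, [/\ F' \subset D a,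
      exists2 s, s \in F' & adj w s /\ (forall x, x \in F' -> connect (radj F') s x),
      h <= #|N2 F'| & #|N2 F'| <= h + q].
    have [sDP cD mD] := DP a.
    have sDZ : D a \subset Z.
      by apply: subset_trans sDP (PZ _ _); apply: ltnW; rewrite ltnS.
    have /clnbP[_ [s sD sw]] := wD a.
    have aw : adj w s.
      case/orP: sw => [/eqP sw|]; last by rewrite adj_sym.
      have at_ : (a : nat) < t by [].
      have /disjointFr/(_ (subsetP sDP _ sD)) : [disjoint P a & P t].
        by apply: P2; rewrite ?ltnS ?leqnn ?(ltnW at_) //; clear -at_; lia.
      by rewrite sw wPt.
    have hD : h <= #|N2 (D a)|.
      have := card_undominated coh Z mD; have := cardsID (clnb Z (D a)) Z.
      have /setIidPr -> := clnb_sub Z (D a); rewrite -/N.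
      have : #|clnb Z (D a)| <= #|N2 (D a)|.
        by apply/subset_leq_card/clnb_ext/clnb_sub.
      by clear -hN h2 qN mq qh qt tq2; lia.
    have [F' [sF' sF cF h1 h2']] := grow_core cD sDZ sD ballq hD.
    by exists F'; split=> //; exists s.
  have /fin_all_exists[F' F'P] := coreP.
  pose v1 i := if i == n then w else v i.
  pose F1 i a := if i == n then (if insub a is Some b then F' b else set0) else F i a.
  have v1n : v1 n = w by rewrite /v1 eqxx.
  have F1n (a : 'I_t) : F1 n a = F' a.
    by rewrite /F1 eqxx insubT //= => lt; congr F'; apply: val_inj.
  have v1o i : i < n -> v1 i = v i by move=> li; rewrite /v1 ifN //; clear -li; lia.
  have F1o i a : i < n -> F1 i a = F i a by move=> li; rewrite /F1 ifN //; clear -li; lia.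
  have Ko i : i < n -> K v1 F1 i = K v F i.
    by move=> li; rewrite /K v1o //; congr (_ :|: _); apply: eq_bigr => a _; rewrite F1o.
  have F'Z (a : 'I_t) : F' a \subset Z :\: X.
    have [sF _ _ _] := F'P a; have [sD _ _] := DP a.
    have [|sP _] := P1 a; first by apply: ltnW; rewrite ltnS.
    by apply: subset_trans sF (subset_trans sD sP).
  have dec i : i < n.+1 -> i = n \/ i < n by clear; lia.
  exists v1, F1; split.
  - by move=> i /dec[->|li]; rewrite ?v1n ?v1o //; apply: vZ.
  - move=> i a /dec[->|li] at_; last first.
      by rewrite /arm v1o // F1o //; apply: hF.
    have := F'P (Ordinal at_) => -[sF sP h1 h3].
    rewrite /arm v1n -[F1 n a]/(F1 n (Ordinal at_)) F1n; split=> //.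
      by apply: subset_trans (F'Z _) _; apply: subsetDl.
    apply/negP => wF; have [sD _ _] := DP (Ordinal at_).
    have /disjointFr/(_ (subsetP sD _ (subsetP sF _ wF))) : [disjoint P a & P t].
      by apply: P2; rewrite ?ltnS ?leqnn ?(ltnW at_) //; clear -at_; lia.
    by rewrite wPt.
  - move=> i a b /dec[->|li] at_ bt ab; last by rewrite !F1o //; apply: disF.
    rewrite -[F1 n a]/(F1 n (Ordinal at_)) -[F1 n b]/(F1 n (Ordinal bt)) !F1n.
    have [sF _ _ _] := F'P (Ordinal at_); have [sD _ _] := DP (Ordinal at_).
    have [sFb _ _ _] := F'P (Ordinal bt); have [sDb _ _] := DP (Ordinal bt).
    apply: disjointI => x /(subsetP sF)/(subsetP sD) xa /(subsetP sFb)/(subsetP sDb).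
    have /disjointFr/(_ xa) : [disjoint P a & P b].
      by apply: P2; rewrite ?ltnS ?(ltnW at_) ?(ltnW bt).
    by move=> /= ->.
  - move=> i k ki /dec[ei|li]; last first.
      by rewrite !Ko //; [apply: farF | apply: ltn_trans li].
    have kn : k < n by rewrite -ei.
    rewrite (Ko k) // ei; apply: disjointI => x xK xN.
    suff: x \in Z :\: X.
      by case/setDP=> _ /negP[]; apply/bigcupP; exists (Ordinal kn).
    move: xK; rewrite /K v1n => /setU1P[->//|/bigcupP[a _]].
    by rewrite F1n; apply: (subsetP (F'Z a)).
have [v [F gvF]] := ex_good t (leqnn t); have [vZ hF disF farF] := gvF.
have KZ i : i < t -> K v F i \subset Z.
  move=> it; rewrite subUset sub1set vZ //=; apply/bigcupsP => a _.
  by have [] := hF i a it (ltn_ord a).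
have FK i a : a < t -> F i a \subset K v F i.
  move=> at_; apply: subset_trans (subsetUr _ _).
  exact: (bigcup_sup (Ordinal at_)).
have vK i : v i \in K v F i by rewrite !inE eqxx.
have far i k x y l : i < t -> k < t -> i != k -> x \in K v F i -> y \in K v F k ->
    l \in Z -> touch x l -> touch l y -> False.
  have one i' k' x' y' : k' < i' -> i' < t -> x' \in K v F i' -> y' \in K v F k' ->
      l \in Z -> touch x' l -> touch l y' -> False.
    move=> ki it xK yK lZ xl ly; have /disjointFr/(_ xK)/negP := farF _ _ ki it.
    apply; apply: (@clnb_trans _ _ _ l); rewrite ?(subsetP (KZ _ it)) 1?touch_sym //.
    by apply/clnbP; split=> //; exists y'; rewrite 1?touch_sym.
  move=> it kt ik xK yK lZ xl ly; case: (ltngtP k i) => lik.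
  - exact: (one i k x y).
  - by apply: (one k i y x) => //; rewrite touch_sym.
  - by rewrite lik eqxx in ik.
(* The end of a route lies in the second neighbourhood of its core but touches no [K v F k]; the
   link [lk] reaches it from the core. The default value [c] of [lk] is never taken for [c] in
   [T i a]. *)
pose B := \bigcup_(k < t) clnb Z (K v F k).
pose T i a := N2 (F i a) :\: B.
pose lk i a c := odflt c [pick l in clnb Z (F i a) | touch l c].
pose R i a c := lk i a c |: (c |: F i a).
(* More than [m] first neighbours would make the second neighbourhood almost all of [Z], far above
   [h + q]. *)
have small_clnb i a : i < t -> a < t -> #|clnb Z (F i a)| <= m.
  move=> it at_; rewrite leqNgt; apply/negP => ltm.
  have := card_clnb2 coh (ltnW ltm); have [_ _ _ + _] := hF i a it at_.
  by rewrite -/N -/(N2 _); clear -hN h2 qN mq qh qt tq2; lia.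
have cB : #|B| <= t * (q + t * m).
  apply: card_bigcup_le => k; rewrite /K clnbU clnb_bigcup.
  apply: leq_trans (leq_card_setU _ _) (leq_add _ _).
    by apply: leq_trans (ballq _ (vZ _ (ltn_ord k))); apply/subset_leq_card/clnb_ext/clnb_sub.
  by apply: card_bigcup_le => a; apply: small_clnb.
have TP i a c : i < t -> a < t -> c \in T i a ->
  [/\ c \in Z, lk i a c \in clnb Z (F i a), touch (lk i a c) c,
      forall k x, k < t -> x \in K v F k -> ~~ touch x c &
      forall k, k < t -> lk i a c \notin K v F k].
  move=> it at_ /setDP[/clnbP[cZ [l lF lc]] cB'].
  have cK k x : k < t -> x \in K v F k -> ~~ touch x c.
    move=> kt xK; apply: contra cB' => xc; apply/bigcupP; exists (Ordinal kt) => //.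
    by apply/clnbP; split=> //; exists x.
  have [l1 l2] : lk i a c \in clnb Z (F i a) /\ touch (lk i a c) c.
    rewrite /lk; case: pickP => [l' /andP[]//|/(_ l)].
    by rewrite /= lF lc.
  split=> // k kt; apply/negP => /(cK _ _ kt); by rewrite l2.
have lkZ i a c : i < t -> a < t -> c \in T i a -> lk i a c \in Z.
  by move=> it at_ /(TP _ _ _ it at_)[_ /clnbP[]].
apply: (@weakly_linked_of_routes G m coh t (2 * q) v T R).
- move=> i j ij; have it : i < t by clear -ij; lia.
  have jt : j < t by clear -ij; lia.
  have nij : i != j by clear -ij; lia.
  have : ~~ touch (v i) (v j).
    apply/negP => tij; apply: (far i j (v i) (v j) (v j)) => //; first exact: vZ.
    by rewrite /touch eqxx.
  by rewrite negb_or => /andP[].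
- move=> i a c it at_ cT; have [cZ lF lc cK lK] := TP _ _ _ it at_ cT.
  have [sFZ [s sF [vs cF]] _ _ vF] := hF i a it at_.
  have sFK := FK i a at_.
  have /clnbP[lZ [f fF fl]] := lF.
  split.
  + have S2 : F i a \subset v i |: R i a c.
      by rewrite /R !setUA; apply: subsetUr.
    apply: (@connect_trans _ _ s).
      by apply: connect1; rewrite /radj /= !inE sF vs eqxx !orbT.
    apply: connect_trans (connect_radjS S2 (cF _ fF)) _.
    apply: (@connect_trans _ _ (lk i a c)).
      apply: connect1; rewrite /radj /= !inE fF eqxx !orbT /=.
      case/orP: fl => // /eqP fl; have := lK i it.
      by rewrite -fl (subsetP sFK).
    case/orP: lc => [/eqP -> //|lc].
    by apply: connect1; rewrite /radj /= !inE lc !eqxx !orbT.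
  + by rewrite !inE eqxx orbT.
  + move=> k kt; rewrite !inE !negb_or; apply/and3P; split.
    * by apply: contra (lK k kt) => /eqP <-.
    * by apply/eqP => vc; have := cK k (v k) kt (vK k); rewrite vc /touch eqxx.
    * case: (eqVneq k i) => [-> //|ki]; apply/negP => vkF.
      apply: (far k i (v k) (v k) (v k)) => //; rewrite ?vZ /touch ?eqxx //.
      exact: (subsetP sFK).
  + move=> k x kt ki; have tch y : adj (v k) y -> touch (v k) y.
      by rewrite /touch => ->; rewrite orbT.
    rewrite !inE => /or3P[/eqP ->|/eqP ->|xF]; apply/negP => /tch tx.
    * by apply: (far k i (v k) f (lk i a c)) => //; rewrite ?(subsetP sFK) 1?touch_sym.
    * by have := cK k (v k) kt (vK k); rewrite tx.
    * apply: (far k i (v k) x x) => //; rewrite ?(subsetP sFK) ?(subsetP sFZ) //.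
      by rewrite /touch eqxx.
(* An end [c'] outside the balls of radius two around the link [l] and the end [c] gives a
   compatible route: links and ends do not touch, and the cores are already disjoint or far
   apart. *)
- move=> i a j a' c it at_ jt at' ne cT.
  have [cZ lF lc cK lK] := TP _ _ _ it at_ cT; set l := lk i a c in lF lc lK.
  have /clnbP[lZ [f fF fl]] := lF.
  apply: (@leq_trans #|N2 [set l] :|: N2 [set c]|); last first.
    by apply: leq_trans (leq_card_setU _ _) _; rewrite mul2n -addnn leq_add ?ballq.
  apply/subset_leq_card/subsetP => c'; rewrite inE => /andP[c'T].
  have [cZ' lF' lc' cK' lK'] := TP _ _ _ jt at' c'T; set l' := lk j a' c' in lF' lc' lK'.
  have /clnbP[lZ' [f' fF' fl']] := lF'.
  apply: contraR; rewrite inE negb_or => /andP[n1 n2].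
  have ext x y : x \in Z -> y \in Z -> y \in clnb Z [set x] -> y \in N2 [set x].
    by move=> xZ yZ; apply: (subsetP (clnb_ext (clnb_sub _ _))).
  have n11 : ~~ touch l l'.
    by apply: contra n1 => ll; apply: (@clnb_trans _ _ _ l'); rewrite ?touch_clnb1.
  have n12 : ~~ touch l c' by apply: contra n1 => ll; apply: ext; rewrite ?touch_clnb1.
  have n21 : ~~ touch c l'.
    by apply: contra n2 => ll; apply: (@clnb_trans _ _ _ l'); rewrite ?touch_clnb1.
  have n22 : ~~ touch c c' by apply: contra n2 => ll; apply: ext; rewrite ?touch_clnb1.
  have sFK := FK i a at_; have sFK' := FK j a' at'.
  have lnF' x : x \in F j a' -> x != l.
    by move=> /(subsetP sFK') xK; apply: contra (lK j jt) => /eqP <-.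
  have lnF x : x \in F i a -> x != l'.
    by move=> /(subsetP sFK) xK; apply: contra (lK' i it) => /eqP <-.
  have cF' x : x \in F j a' -> ~~ touch x c by move=> /(subsetP sFK')/cK; apply.
  have cF x : x \in F i a -> ~~ touch x c' by move=> /(subsetP sFK)/cK'; apply.
  rewrite /compatible; case: (eqVneq i j) => [ij|ij].
    have aa : a != a' by apply: contra ne => /eqP ->; rewrite ij.
    have ntE x y : ~~ touch x y -> x == y -> False.
      by move=> n /eqP e; move: n; rewrite e /touch eqxx.
    apply: disjointI => x; rewrite !inE -/l -/l'.
    move=> /or3P[/eqP->|/eqP->|xF] /or3P[e|e|e].
    + exact: ntE n11 e.
    + exact: ntE n12 e.
    + by have := lnF' _ e; rewrite eqxx.
    + exact: ntE n21 e.
    + exact: ntE n22 e.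
    + by have := cF' _ e; rewrite /touch eqxx.
    + by have := lnF _ xF; rewrite e.
    + by apply: ntE (cF _ xF) e.
    + have /disjointFr/(_ xF) := disF i a a' it at_ at' aa.
      by rewrite ij e.
  apply/forall_inP => x; rewrite !inE -/l => xR; apply/forall_inP => y.
  rewrite !inE -/l'; move: xR; move=> /or3P[/eqP->|/eqP->|xF] /or3P[/eqP->|/eqP->|yF] //.
  + by apply/negP => ly; apply: (far i j f y l) => //; rewrite ?(subsetP sFK) ?(subsetP sFK').
  + by rewrite touch_sym; apply: cF'.
  + apply/negP => xl; apply: (far i j x f' l') => //; rewrite ?(subsetP sFK) ?(subsetP sFK') //.
    by rewrite touch_sym.
  + exact: cF.
  + apply/negP => xy; apply: (far i j x y y) => //; rewrite ?(subsetP sFK) ?(subsetP sFK') //.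
      by apply: (subsetP (KZ _ jt)); apply: (subsetP sFK').
    by rewrite /touch eqxx.
- move=> i a it at_; have [_ _ h1 _ _] := hF i a it at_.
  have := cardsID B (N2 (F i a)).
  have : #|N2 (F i a) :&: B| <= #|B| by apply/subset_leq_card/subsetIr.
  rewrite -/(T i a) => e1 e2.
  have e3 : t * (q + t * m) <= 2 * (t ^ 2 * q).
    have : t ^ 2 * m <= t ^ 2 * q by rewrite leq_mul2l mq orbT.
    have -> : t * (q + t * m) = t * q + t ^ 2 * m by clear; nia.
    by clear -tq2; lia.
  have e4 : 2 * t ^ 2 * (2 * q) = 4 * (t ^ 2 * q) by clear; nia.
  by rewrite e4; clear -e1 e2 e3 cB h1 qh mq qt tq2; lia.
Qed.

(** * Small degrees, large second neighbourhoods *)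

(** Count the related pairs in two ways: every [x] is related to at least a [1 / K] share of [B],
    every [y] to at most [p] elements of [A]. *)
Lemma card_many_partners (S T : finType) (A : {set S}) (B : {set T}) (r : S -> T -> bool) p K :
    (forall y, y \in B -> #|[set x in A | r x y]| <= p) ->
    (forall x, x \in A -> #|B| <= K * #|[set y in B | r x y]|) ->
    0 < #|B| ->
  #|A| <= K * p.
Proof.
move=> hB hA B0; rewrite -(leq_pmul2r B0) -mulnA (mulnC p).
have cardE (U : finType) (C : {set U}) (f : U -> bool) :
    #|[set x in C | f x]| = \sum_(x in C) f x.
  rewrite -sum1dep_card big_mkcondr; apply: eq_bigr => x _; by case: (f x).
apply: (@leq_trans (\sum_(x in A) K * #|[set y in B | r x y]|)).
  by rewrite -sum_nat_const; apply: leq_sum => x xA; apply: hA.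
rewrite -big_distrr leq_mul2l; apply/orP; right.
under eq_bigr do rewrite cardE.
rewrite exchange_big /= -sum_nat_const; apply: leq_sum => y yB.
by rewrite -cardE hB.
Qed.

(** A route runs from its branch vertex [v i] through a link to an end at distance two. Before each
    new choice, the vertices touching many earlier routes are deleted; hence a focus is required in
    every [Z'] of at least half the size. *)
Lemma focused_weakly_linked t E2 : 0 < t -> 0 < E2 ->
  exists E1, 0 < E1 /\ forall (G : sgraph) m (Z : {set G}),
    0 < m -> coherent G m -> E1 * m <= #|Z| ->
    (forall x, x \in Z -> E1 * #|clnb Z [set x]| <= #|Z|) ->
    (forall Z' : {set G}, Z' \subset Z -> #|Z| <= 2 * #|Z'| ->
       exists2 v, v \in Z' & #|Z'| <= E2 * #|clnb Z' (clnb Z' [set v])|) ->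
  weakly_linked G t.
Proof.
(* [1 / K2] is the share of the routes at a later branch vertex that one route may obstruct, [1 / K]
   the share of earlier routes that a later vertex may touch. [K] is such that the routes discarded
   from any [T k] amount to at most half of it. *)
move=> t0 E20; pose K2 := 32 * (E2 * t ^ 2); pose K := 2 * (t * (1 + 2 * K2)).
have K20 : 0 < K2 by rewrite !muln_gt0 E20 t0.
have K0 : 0 < K by rewrite !muln_gt0 t0.
(* The summands pay, in turn, for the deleted set [Y], for the first neighbourhood removed from [B],
   and for routes sharing a vertex with a given one. *)
pose E1 := 2 * (t * (2 * K + 1)) + 32 * E2 + 4 * K2; exists E1.
have E10 : 0 < E1 by rewrite /E1; lia.
split=> // G m Z m0 coh mZ degE ballE; set N := #|Z|; pose d := N %/ E1.
have md : m <= d by rewrite leq_divRL // mulnC.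
have degd x : x \in Z -> #|clnb Z [set x]| <= d.
  by move=> /degE; rewrite leq_divRL // mulnC.
have dN c : c <= E1 -> c * d <= N.
  move=> cE; apply: leq_trans (leq_divM N E1); rewrite -/d mulnC.
  by rewrite leq_mul2l cE orbT.
have dN1 : 2 * (t * (2 * K + 1)) * d <= N by apply: dN; rewrite /E1; clear; lia.
have dN2 : 32 * E2 * d <= N by apply: dN; rewrite /E1; clear; lia.
have dN3 : 4 * K2 * d <= N by apply: dN; rewrite /E1; clear; lia.
have N0 : 0 < N by apply: leq_trans mZ; rewrite muln_gt0 E10.
pose hit (T : nat -> {set G}) (l : nat -> G -> G) k x :=
  [set c in T k | touch (l k c) x || touch c x].
pose good n (v : nat -> G) (T : nat -> {set G}) (l : nat -> G -> G) :=
  [/\ forall i, i < n -> [/\ v i \in Z, T i \subset Z & N <= 4 * E2 * #|T i|],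
      forall i c, i < n -> c \in T i ->
        [/\ l i c \in Z, adj (v i) (l i c), adj (l i c) c & ~~ touch (v i) c],
      forall i k, k < i -> i < n -> ~~ touch (v k) (v i) /\
        (forall c, c \in T i -> ~~ touch (v k) (l i c) /\ ~~ touch (v k) c) &
      forall i k, k < i -> i < n -> K * #|hit T l k (v i)| <= #|T k| /\
        (forall c, c \in T i -> K * #|hit T l k (l i c)| <= #|T k| /\
                               K * #|hit T l k c| <= #|T k|)].
have [z0 z0Z] : exists z0, z0 \in Z by apply/set0Pn; rewrite -card_gt0.
have ex_good n : n <= t -> exists v T l, good n v T l.
  elim: n => [|n IHn] ltn.
    by exists (fun _ => z0), (fun _ => set0), (fun _ c => c); split.
  have [v [T [l gvT]]] := IHn (ltnW ltn); have [vP lP farP hitP] := gvT.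
  (* A route has two vertices besides its branch vertex, each touching at most [d] vertices; hence
     few vertices touch more than a [1 / K] share of the routes. *)
  pose X k := [set x in Z | #|T k| < K * #|hit T l k x|].
  have cX k : k < n -> #|X k| <= K * (2 * d).
    move=> kn; have [vZ sTZ cT] := vP k kn.
    apply: (@card_many_partners _ _ (X k) (T k) (fun x c => touch (l k c) x || touch c x)).
    - move=> c cT'; have [lZ _ _ _] := lP k c kn cT'.
      apply: (@leq_trans #|clnb Z [set l k c] :|: clnb Z [set c]|).
        apply/subset_leq_card/subsetP => x; rewrite !clnb1 !inE => /andP[/andP[-> _]] /=.
        by [].
      rewrite mul2n -addnn; apply: leq_trans (leq_card_setU _ _) (leq_add _ _); apply: degd => //.
      exact: (subsetP sTZ).
    - by move=> x; rewrite inE => /andP[_ /ltnW].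
    - by rewrite lt0n; apply/eqP => e0; move: cT; rewrite e0 muln0 leqNgt N0.
  pose Y := \bigcup_(k < n) (X k :|: clnb Z [set v k]).
  have cY : #|Y| <= n * (K * (2 * d) + d).
    apply: card_bigcup_le => k; apply: leq_trans (leq_card_setU _ _) (leq_add (cX _ _) _) => //.
    by apply: degd; have [] := vP k (ltn_ord k).
  pose Z' := Z :\: Y.
  have sZ' : Z' \subset Z by apply: subsetDl.
  have cZ' : N <= 2 * #|Z'|.
    have := cardsID Y Z; have : #|Z :&: Y| <= #|Y| by apply/subset_leq_card/subsetIr.
    have e1 : n * (K * (2 * d) + d) <= t * (K * (2 * d) + d) by rewrite leq_mul2r (ltnW ltn) orbT.
    have e2 : 2 * (t * (2 * K + 1)) * d = 2 * (t * (K * (2 * d) + d)) by clear; nia.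
    rewrite -/N -/Z'; rewrite e2 in dN1; move: dN1 e1 cY; clear.
    by set a := t * _; set b := n * _; lia.
  have [w wZ' wB] := ballE Z' sZ' cZ'; set B := clnb Z' _ in wB.
  have wZ : w \in Z := subsetP sZ' _ wZ'.
  (* Without the first neighbourhood of [w], all ends are at distance exactly two from it. *)
  pose Tw := B :\: clnb Z [set w].
  pose lw c := odflt c [pick y in Z' | adj w y && adj y c].
  have sTw : Tw \subset Z' by apply: subset_trans (subsetDl _ _) (clnb_sub _ _).
  have lwP c : c \in Tw -> [/\ lw c \in Z', adj w (lw c), adj (lw c) c & ~~ touch w c].
    case/setDP=> /clnbP[cinZ' [y yw yc]] cw.
    have nwc : ~~ touch w c by apply: contra cw => wc; rewrite touch_clnb1 // (subsetP sZ').
    move: yw; rewrite clnb1 inE => /andP[yZ' wy].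
    have awy : adj w y.
      by case/orP: wy => // /eqP wy; move: nwc; rewrite wy yc.
    have ayc : adj y c.
      by case/orP: yc => // /eqP yc; move: nwc; rewrite -yc /touch awy orbT.
    rewrite /lw; case: pickP => [y' /= /and3P[]//|/(_ y)].
    by rewrite /= yZ' awy ayc.
  have notY x : x \in Z' -> forall k, k < n ->
      K * #|hit T l k x| <= #|T k| /\ ~~ touch (v k) x.
    case/setDP=> xZ xY k kn; have : x \notin X k :|: clnb Z [set v k].
      by apply: contra xY => h; apply/bigcupP; exists (Ordinal kn).
    rewrite !inE negb_or xZ /= -leqNgt => /andP[-> h]; split=> //.
    apply: contra h => vx; apply/exists_inP; exists (v k); rewrite ?set11 //.
  pose v1 i := if i == n then w else v i.
  pose T1 i := if i == n then Tw else T i.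
  pose l1 i := if i == n then lw else l i.
  have v1n : v1 n = w by rewrite /v1 eqxx.
  have T1n : T1 n = Tw by rewrite /T1 eqxx.
  have l1n : l1 n = lw by rewrite /l1 eqxx.
  have no i : i < n -> (i == n) = false by clear; lia.
  have v1o i : i < n -> v1 i = v i by move=> /no e; rewrite /v1 e.
  have T1o i : i < n -> T1 i = T i by move=> /no e; rewrite /T1 e.
  have l1o i : i < n -> l1 i = l i by move=> /no e; rewrite /l1 e.
  have hit1 k x : k < n -> hit T1 l1 k x = hit T l k x.
    by move=> kn; rewrite /hit T1o // l1o.
  have dec i : i < n.+1 -> i = n \/ i < n by clear; lia.
  exists v1, T1, l1; split.
  - move=> i /dec[->|li]; last by rewrite v1o // T1o //; apply: vP.
    rewrite v1n T1n; split=> //; first exact: subset_trans sZ'.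
    have := cardsID (clnb Z [set w]) B.
    have : #|B :&: clnb Z [set w]| <= d.
      by apply: leq_trans (degd _ wZ); apply/subset_leq_card/subsetIr.
    rewrite -/Tw => e1 e2; rewrite -mulnA.
    have e3 : E2 * #|B| <= E2 * d + E2 * #|Tw|.
      by rewrite -mulnDr leq_mul2l -e2 leq_add2r e1 orbT.
    move: dN2 wB e3 cZ'; rewrite -mulnA -/N; clear.
    by set a := E2 * d; set b := E2 * #|B|; set c := E2 * #|Tw|; lia.
  - move=> i c /dec[->|li]; last by rewrite v1o // T1o // l1o //; apply: lP.
    by rewrite v1n T1n l1n => /lwP[/(subsetP sZ')].
  - move=> i k ki /dec[ei|li]; last first.
      have kn := ltn_trans ki li; rewrite !v1o // T1o // l1o //; exact: farP.
    have kn : k < n by rewrite -ei.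
    rewrite ei v1n T1n l1n v1o //; split; first by have [] := notY _ wZ' _ kn.
    move=> c cT; have [lZ' _ _ _] := lwP c cT; split.
      by have [] := notY _ lZ' _ kn.
    by have [] := notY _ (subsetP sTw _ cT) _ kn.
  - move=> i k ki /dec[ei|li]; last first.
      have kn := ltn_trans ki li; rewrite !v1o // hit1 // !T1o // l1o //.
      have [h1 h2] := hitP _ _ ki li; split=> // c /h2.
      by rewrite !hit1.
    have kn : k < n by rewrite -ei.
    rewrite ei v1n T1n l1n hit1 // T1o //; split; first by have [] := notY _ wZ' _ kn.
    move=> c cT; have [lZ' _ _ _] := lwP c cT; rewrite !hit1 //; split.
      by have [] := notY _ lZ' _ kn.
    by have [] := notY _ (subsetP sTw _ cT) _ kn.
have [v [T [l [vP lP farP hitP]]]] := ex_good t (leqnn t).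
(* So far each later vertex touches few earlier routes. Double counting turns this around: few
   earlier routes obstruct many routes of a later branch vertex, and these are discarded along with
   the routes touching [v i] itself. *)
pose cf k c i c' := (touch (l k c) (l i c') || touch c (l i c')) ||
                    (touch (l k c) c' || touch c c').
pose bad k (i : 'I_t) :=
  [set c in T k | (k < i) && (#|T i| < K2 * #|[set c' in T i | cf k c i c']|)]
  :|: (if k < i then hit T l k (v i) else set0).
pose T' k := T k :\: \bigcup_(i < t) bad k i.
have cfle k i c' : k < i -> i < t -> c' \in T i ->
    K * #|[set c in T k | cf k c i c']| <= 2 * #|T k|.
  move=> ki it c'T; have [_ /(_ _ c'T)[h1 h2]] := hitP _ _ ki it.
  apply: (@leq_trans (K * (#|hit T l k (l i c')| + #|hit T l k c'|))).
    rewrite leq_mul2l; apply/orP; right; apply: leq_trans (leq_card_setU _ _).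
    by apply/subset_leq_card/subsetP => c; rewrite !inE /cf => /andP[-> /orP[]->]; rewrite ?orbT.
  by rewrite mulnDr mul2n -addnn leq_add.
have Tgt0 k : k < t -> 0 < #|T k|.
  move=> kt; have [_ _] := vP k kt; case: (posnP #|T k|) => // ->.
  by rewrite muln0 leqNgt N0.
have cbad k (i : 'I_t) : k < t -> K * #|bad k i| <= (1 + 2 * K2) * #|T k|.
  move=> kt; case: (ltnP k i) => ki; last first.
    rewrite /bad ltnNge ki /= setU0 (_ : [set c in _ | _] = set0) ?cards0 ?muln0 //.
    by apply/setP => c; rewrite !inE andbF.
  have [h1 _] := hitP _ _ ki (ltn_ord i).
  rewrite /bad ki; set C := [set c in _ | _].
  have cC : #|C| <= K2 * ((2 * #|T k|) %/ K).
    apply: (@card_many_partners _ _ C (T i) (fun c c' => cf k c i c')).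
    - move=> c' c'T; rewrite leq_divRL // mulnC; apply: leq_trans (cfle _ _ _ ki _ c'T) => //.
      rewrite leq_mul2l; apply/orP; right; apply/subset_leq_card/subsetP => c.
      by rewrite !inE => /andP[/andP[-> _]].
    - by move=> c; rewrite inE => /andP[_ /andP[_ /ltnW]].
    - exact: Tgt0.
  apply: leq_trans (_ : K * (#|C| + #|hit T l k (v i)|) <= _).
    by rewrite leq_mul2l leq_card_setU orbT.
  rewrite mulnDr mulnDl mul1n addnC leq_add //.
  apply: leq_trans (_ : K * (K2 * ((2 * #|T k|) %/ K)) <= _).
    by rewrite leq_mul2l cC orbT.
  rewrite mulnCA -(mulnA 2 K2) [X in _ <= X]mulnCA leq_mul2l [K * _]mulnC leq_divM.
  by rewrite orbT.
have cT' k : k < t -> N <= 8 * (E2 * #|T' k|).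
  move=> kt; have [_ _] := vP k kt; rewrite -mulnA.
  suff : #|T k| <= 2 * #|T' k|.
    move=> h; have : E2 * #|T k| <= E2 * (2 * #|T' k|) by rewrite leq_mul2l h orbT.
    by clear; set a := E2 * #|T k|; rewrite mulnCA; set b := E2 * _; lia.
  set Y := \bigcup_(i < t) bad k i.
  have cY : #|Y| <= t * (((1 + 2 * K2) * #|T k|) %/ K).
    by apply: card_bigcup_le => i; rewrite leq_divRL // mulnC cbad.
  have cY2 : 2 * #|Y| <= #|T k|.
    have h : 0 < t * (1 + 2 * K2) by rewrite muln_gt0 t0.
    rewrite -(leq_pmul2r h); apply: leq_trans (_ : K * #|Y| <= _).
      by rewrite /K; clear; nia.
    apply: leq_trans (_ : K * (t * (((1 + 2 * K2) * #|T k|) %/ K)) <= _).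
      by rewrite leq_mul2l cY orbT.
    rewrite mulnCA (mulnC #|T k|) -mulnA leq_mul2l; apply/orP; right.
    by rewrite mulnC leq_divM.
  have := cardsID Y (T k); have : #|T k :&: Y| <= #|Y| by apply/subset_leq_card/subsetIr.
  by rewrite -/(T' k); move: cY2; clear; lia.
have T'T k c : c \in T' k -> c \in T k by case/setDP.
have T'P k c i : k < t -> i < t -> k < i -> c \in T' k ->
   [/\ K2 * #|[set c' in T i | cf k c i c']| <= #|T i|,
       ~~ touch (l k c) (v i) & ~~ touch c (v i)].
  move=> kt it ki /setDP[cT cn]; have : c \notin bad k (Ordinal it).
    by apply: contra cn => h; apply/bigcupP; exists (Ordinal it).
  by rewrite /bad /= ki !inE cT /= => /norP[+ /norP[-> ->]]; rewrite -leqNgt => ->.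
have TZ k c : k < t -> c \in T k -> c \in Z.
  by move=> kt cT; have [_ /subsetP sT _] := vP k kt; apply: sT.
have farR i c k : i < t -> k < t -> k != i -> c \in T' i ->
    ~~ touch (v k) (l i c) /\ ~~ touch (v k) c.
  move=> it kt ki cT; case: (ltngtP k i) => lki.
  - by have [_ /(_ _ (T'T _ _ cT))] := farP _ _ lki it.
  - by have [_ h1 h2] := T'P _ _ _ it kt lki cT; rewrite !(touch_sym (v k)).
  - by rewrite lki eqxx in ki.
pose R i (a : nat) c := [set l i c; c].
apply: (@weakly_linked_of_routes G m coh t (N %/ K2) v (fun i _ => T' i) R).
- move=> i j ij; have it : j < t by clear -ij; lia.
  have lij : i < j by clear -ij; lia.
  by have [+ _] := farP _ _ lij it; rewrite negb_or => /andP[].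
- move=> i a c it at_ cT; have [lZ vl lc nvc] := lP _ _ it (T'T _ _ cT).
  split.
  + apply: (@connect_trans _ _ (l i c)); apply: connect1; rewrite /radj /= !inE !eqxx !orbT //.
  + by rewrite !inE eqxx orbT.
  + move=> k kt; rewrite !inE negb_or; case: (eqVneq k i) => [->|ki].
      apply/andP; split; apply/eqP => e; first by rewrite -e adj_irr in vl.
      by move: nvc; rewrite e /touch eqxx.
    have [n1 n2] := farR _ _ _ it kt ki cT.
    by apply/andP; split; [apply: contra n1|apply: contra n2] => /eqP ->; rewrite /touch eqxx.
  + move=> k x kt ki; have [n1 n2] := farR _ _ _ it kt ki cT.
    rewrite !inE => /orP[]/eqP ->; [apply: contra n1|apply: contra n2] => h;
      by rewrite /touch h orbT.
- move=> i a j a' c it at_ jt at' ne cT; have [lZ vl lc nvc] := lP _ _ it (T'T _ _ cT).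
  have cZ := TZ _ _ it (T'T _ _ cT).
  (* Towards a later branch vertex the bound comes from discarding bad routes, towards an earlier
     one from the choice of the later vertices, and at the same one from small first
     neighbourhoods. *)
  rewrite leq_divRL // mulnC /compatible; case: (ltngtP i j) => ij.
  + have [h _ _] := T'P _ _ _ it jt ij cT.
    have [_ sTZ _] := vP j jt.
    apply: leq_trans (leq_trans h (subset_leq_card sTZ)).
    rewrite leq_mul2l; apply/orP; right; apply/subset_leq_card/subsetP => c'.
    rewrite inE => /andP[c'T]; rewrite inE (T'T _ _ c'T) /=; apply: contraR.
    move=> /norP[/norP[n1 n2] /norP[n3 n4]].
    apply/forall_inP => x; rewrite !inE => xR; apply/forall_inP => y; rewrite !inE.
    by move: xR => /orP[]/eqP-> /orP[]/eqP->.
  + have h := cfle _ _ _ ij it (T'T _ _ cT).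
    have [_ sTZ _] := vP j jt.
    rewrite -(leq_pmul2l K0) mulnCA; apply: leq_trans (_ : K2 * (2 * #|T j|) <= _).
      rewrite leq_mul2l; apply/orP; right; apply: leq_trans h.
      rewrite leq_mul2l; apply/orP; right; apply/subset_leq_card/subsetP => c'.
      rewrite inE => /andP[c'T]; rewrite inE (T'T _ _ c'T) /=; apply: contraR.
      move=> /norP[/norP[n1 n2] /norP[n3 n4]].
      apply/forall_inP => x; rewrite !inE => xR; apply/forall_inP => y; rewrite !inE.
      by move: xR => /orP[]/eqP-> /orP[]/eqP->; rewrite touch_sym.
    rewrite mulnA leq_mul ?subset_leq_card // /K.
    by apply: leq_trans (_ : 2 * (1 + 2 * K2) <= _); [clear; lia | rewrite leq_mul2l leq_pmull].
  + subst j; apply: leq_trans (_ : K2 * (d + d) <= _); last first.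
      by move: dN3; clear; nia.
    rewrite leq_mul2l; apply/orP; right.
    apply: leq_trans (_ : #|clnb Z [set l i c] :|: clnb Z [set c]| <= _); last first.
      by apply: leq_trans (leq_card_setU _ _) (leq_add _ _); apply: degd.
    apply/subset_leq_card/subsetP => c'; rewrite inE => /andP[c'T].
    have [lZ' _ lc' _] := lP _ _ it (T'T _ _ c'T).
    apply: contraR; rewrite !clnb1 !inE (TZ _ _ it (T'T _ _ c'T)) /= => /norP[n1 n2].
    have tlc : touch (l i c') c' by rewrite /touch lc' orbT.
    apply: disjointI => x; rewrite !inE => /orP[]/eqP-> /orP[]/eqP e.
    * by move: n1; rewrite e tlc.
    * by move: n1; rewrite e /touch eqxx.
    * by move: n2; rewrite e tlc.
    * by move: n2; rewrite e /touch eqxx.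
- move=> i a it _; have := cT' i it; set a0 := #|T' i|.
  have h1 : K2 * (N %/ K2) <= N by rewrite mulnC leq_divM.
  have h2 : 32 * (E2 * m) <= N.
    by apply: leq_trans dN2; rewrite mulnA leq_mul2l md orbT.
  have h0 : 0 < 8 * E2 by rewrite muln_gt0 E20.
  move=> h3; rewrite -(leq_pmul2l h0).
  (* With [K2 = 32 * (E2 * t ^ 2)], each of the two terms is at most half of [N]. *)
  have -> : 8 * E2 * (2 * m + 2 * t ^ 2 * (N %/ K2)) =
     16 * (E2 * m) + 16 * (E2 * t ^ 2 * (N %/ K2)) by clear; nia.
  move: h1 h2 h3; rewrite /K2 -!mulnA; clear.
  by set x := E2 * m; set y := E2 * (_ * _); set z := E2 * a0; lia.
Qed.

(** * Tuples of almost minimal density *)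

Section Density.
Local Open Scope ring_scope.
Variables (F : realFieldType) (G : sgraph) (t : nat).
Implicit Types (x y z : G) (A B C W : {set G}) (h : G -> F) (Y Z : 'I_t -> {set G}).

(** Division by zero makes this [0] on the empty set. *)
Definition avg A h : F := (\sum_(x in A) h x) / #|A|%:R.

Definition load Y k x : F := \sum_(j | j != k) avg (Y j) (fun y => (adj x y)%:R).

(** The densities are summed over ordered pairs, so each pair of parts counts twice. *)
Definition phi Y := \sum_i avg (Y i) (load Y i).

Definition upd Y k A : 'I_t -> {set G} := fun i => if i == k then A else Y i.

Lemma avgD A h1 h2 : avg A (fun x => h1 x + h2 x) = avg A h1 + avg A h2.
Proof. by rewrite /avg big_split mulrDl. Qed.

Lemma avg_sum (I : finType) (P : pred I) A (h : I -> G -> F) :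
  avg A (fun x => \sum_(i | P i) h i x) = \sum_(i | P i) avg A (h i).
Proof. by rewrite /avg exchange_big mulr_suml. Qed.

Lemma eq_avg A h1 h2 : {in A, h1 =1 h2} -> avg A h1 = avg A h2.
Proof. by move=> e; rewrite /avg; congr (_ / _); apply: eq_bigr. Qed.

Lemma avg_exchange A B (f : G -> G -> F) :
  avg A (fun x => avg B (f x)) = avg B (fun y => avg A (fun x => f x y)).
Proof.
rewrite /avg; under eq_bigr do rewrite mulr_suml.
rewrite exchange_big /= mulr_suml [RHS]mulr_suml; apply: eq_bigr => y _.
by rewrite -mulr_suml mulrAC.
Qed.

Lemma avg_le A h1 h2 : {in A, forall x, h1 x <= h2 x} -> avg A h1 <= avg A h2.
Proof. by move=> le; rewrite /avg ler_wpM2r ?invr_ge0 // ler_sum. Qed.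

Lemma avg_const A a : (0 < #|A|)%N -> avg A (fun=> a) = a.
Proof.
by move=> A0; rewrite /avg sumr_const -[a *+ _]mulr_natr mulfK // pnatr_eq0 -lt0n.
Qed.

Lemma avg_ge0 A h : {in A, forall x, 0 <= h x} -> 0 <= avg A h.
Proof. by move=> h0; rewrite /avg divr_ge0 // sumr_ge0. Qed.

Lemma avg_le_const A h a : 0 <= a -> {in A, forall x, h x <= a} -> avg A h <= a.
Proof.
move=> a0 ha; case: (posnP #|A|) => [A0|A0]; first by rewrite /avg A0 invr0 mulr0.
by rewrite -(avg_const a A0); apply: avg_le.
Qed.

Lemma avg_ge_const A h a : (0 < #|A|)%N -> {in A, forall x, a <= h x} -> a <= avg A h.
Proof. by move=> A0 ha; rewrite -(avg_const a A0); apply: avg_le. Qed.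

Lemma avg_adj_nb B x : avg B (fun y => (adj x y)%:R) = #|nb x :&: B|%:R / #|B|%:R.
Proof.
rewrite /avg; congr (_ / _); rewrite -natr_sum -sum1dep_card; congr (_%:R).
rewrite big_mkcond [RHS]big_mkcond; apply: eq_bigr => y _.
by rewrite !inE andbC; case: (y \in B); case: (adj x y).
Qed.

Lemma avg_adjC A B : avg A (fun x => avg B (fun y => (adj x y)%:R)) =
  avg B (fun x => avg A (fun y => (adj x y)%:R)).
Proof.
rewrite avg_exchange; apply: eq_avg => y _; apply: eq_avg => x _.
by rewrite adj_sym.
Qed.

Lemma avg_split A B h : A \subset B -> (0 < #|B|)%N ->
  #|B|%:R * avg B h = #|A|%:R * avg A h + #|B :\: A|%:R * avg (B :\: A) h.
Proof.
move=> sAB B0.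
have E C : #|C|%:R * avg C h = \sum_(x in C) h x.
  case: (posnP #|C|) => [C0|C0].
    by rewrite C0 mul0r; move/eqP: C0; rewrite cards_eq0 => /eqP ->; rewrite big_set0.
  by rewrite /avg mulrC divfK // pnatr_eq0 -lt0n.
by rewrite !E (big_setID A) /=; have /setIidPr -> := sAB.
Qed.

Lemma eq_phi Y Z : Y =1 Z -> phi Y = phi Z.
Proof.
move=> e; rewrite /phi; apply: eq_bigr => i _; rewrite e; apply: eq_avg => x _.
by apply: eq_bigr => j _; rewrite e.
Qed.

Lemma load_ge0 Y k x : 0 <= load Y k x.
Proof. by apply: sumr_ge0 => j _; apply: avg_ge0. Qed.

Lemma phi_ge0 Y : 0 <= phi Y.
Proof. by apply: sumr_ge0 => i _; apply: avg_ge0 => x _; apply: load_ge0. Qed.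

Lemma phi_le Y : phi Y <= (t ^ 2)%:R.
Proof.
apply: le_trans (_ : \sum_(i < t) t%:R <= _); last first.
  by rewrite sumr_const card_ord -mulrnA mulnn.
apply: ler_sum => i _; apply: avg_le_const => // x _.
apply: le_trans (_ : \sum_(j < t) (1 : F) <= _); last by rewrite sumr_const card_ord.
rewrite /load big_mkcond; apply: ler_sum => j _; case: ifP => // _.
by apply: avg_le_const => // y _; case: (adj x y).
Qed.

(** Only densities involving part [k] change, and each occurs in both orders. Hence [phi] depends on
    one part through an average alone, and is affine in it. *)
Lemma phi_upd Y k : exists b, forall A, phi (upd Y k A) = b + 2 * avg A (load Y k).
Proof.
exists (\sum_(i | i != k) avg (Y i)
   (fun x => \sum_(j | (j != i) && (j != k)) avg (Y j) (fun y => (adj x y)%:R))) => A.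
rewrite /phi (bigD1 k) //=.
have -> : avg (upd Y k A k) (load (upd Y k A) k) = avg A (load Y k).
  rewrite {1}/upd eqxx; apply: eq_avg => x _; apply: eq_bigr => j jk.
  by rewrite /upd (negbTE jk).
have -> : \sum_(i | i != k) avg (upd Y k A i) (load (upd Y k A) i) =
  \sum_(i | i != k) avg (Y i) (fun x => avg A (fun y => (adj x y)%:R)) +
  \sum_(i | i != k) avg (Y i)
   (fun x => \sum_(j | (j != i) && (j != k)) avg (Y j) (fun y => (adj x y)%:R)).
  rewrite -big_split; apply: eq_bigr => i ik /=; rewrite -avgD.
  rewrite {1}/upd (negbTE ik); apply: eq_avg => x _.
  rewrite /load (bigD1 k) 1?eq_sym //= {1}/upd eqxx; congr (_ + _).
  by apply: eq_bigr => j /andP[_ jk]; rewrite /upd (negbTE jk).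
have -> : \sum_(i | i != k) avg (Y i) (fun x => avg A (fun y => (adj x y)%:R)) =
    avg A (load Y k).
  rewrite /load avg_sum; apply: eq_bigr => i _; exact: avg_adjC.
by ring.
Qed.

Lemma phi_upd_id Y k : phi (upd Y k (Y k)) = phi Y.
Proof. by apply: eq_phi => i; rewrite /upd; case: eqP => // ->. Qed.

(** Discarding an element of largest value never raises the average. *)
Lemma low_avg_subset A s h : (0 < s <= #|A|)%N ->
  exists B : {set G}, [/\ B \subset A, #|B| = s & avg B h <= avg A h].
Proof.
move: {2}(#|A| - s)%N (leqnn (#|A| - s)) => n; elim: n A => [|n IHn] A.
  rewrite leqn0 subn_eq0 => le1 /andP[s0 le2]; exists A; split=> //.
  by apply/eqP; rewrite eqn_leq le1.
move=> le1 /andP[s0]; rewrite leq_eqVlt => /predU1P[->|ltsA]; first by exists A.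
have [x0 x0A] : exists x, x \in A 
  by apply/set0Pn; rewrite -card_gt0; apply: leq_trans s0 (ltnW ltsA).
case: (arg_maxP h x0A) => x xA maxx; have {}xA : x \in A := xA.
have cA : #|A| = #|A :\ x|.+1 by rewrite (cardsD1 x A) xA.
have [||B [sB cB leB]] := IHn (A :\ x).
- by rewrite cA in le1 ltsA; move: le1 ltsA; clear; lia.
- by rewrite s0 -ltnS -cA.
exists B; split=> //; first by apply: subset_trans sB _; apply: subsetDl.
apply: le_trans leB _.
have n0 : 0 < #|A :\ x|%:R :> F 
  by rewrite ltr0n -ltnS -cA; apply: leq_ltn_trans s0 ltsA.
have e := @avg_split [set x] A h; rewrite sub1set xA -/(A :\ x) cA cards1 in e.
have {e} := e isT isT; rewrite {2}/avg big_set1 cards1 -natr1.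
have lex : avg A h <= h x.
  rewrite /avg ler_pdivrMr ?ltr0n ?cA // -cA mulr_natr -sumr_const.
  by apply: ler_sum => y yA; apply: maxx.
move: n0 lex; set a := #|_|%:R; set u := avg _ _; set w := avg _ _ => n0 lex e.
by nra.
Qed.

(** By [phi_upd], parts may be replaced one after another by subsets of no larger average load. *)
Lemma shrink_tuple Y s : (0 < s)%N -> (forall i, (s <= #|Y i|)%N) ->
  exists Z, [/\ forall i, Z i \subset Y i, forall i, #|Z i| = s & phi Z <= phi Y].
Proof.
move=> s0 leY.
suff H n : (n <= t)%N -> exists Z, [/\ forall i, Z i \subset Y i, forall i, (s <= #|Z i|)%N,
    forall i : 'I_t, (i < n)%N -> #|Z i| = s & phi Z <= phi Y].
  by have [Z [sZ _ cZ leZ]] := H t (leqnn t); exists Z; split=> // i; apply: cZ.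
elim: n => [|n IHn] lt; first by exists Y; split.
have [Z [sZ leZ cZ phiZ]] := IHn (ltnW lt); pose k := Ordinal lt.
have [|B [sB cB leB]] := @low_avg_subset (Z k) s (load Z k); first by rewrite s0 leZ.
have [b bE] := phi_upd Z k.
exists (upd Z k B); split.
- by move=> i; rewrite /upd; case: eqP => // ->; apply: subset_trans sB (sZ k).
- by move=> i; rewrite /upd; case: eqP => // _; rewrite cB.
- move=> i; rewrite ltnS leq_eqVlt => /predU1P[e|li].
    by rewrite /upd ifT //; apply/eqP/val_inj.
  by rewrite /upd; case: eqP => // _; apply: cZ.
- apply: le_trans phiZ; rewrite -(phi_upd_id Z k) !bE.
  by rewrite lerD2l ler_pM2l.
Qed.

(** Descent: unless [Y] is almost minimal among tuples with parts at least [1 / K] as large, pass to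
    one with [phi] lower by more than [eps] and trim its parts. As [phi] is nonnegative, this ends
    within [r] rounds. *)
Lemma near_minimal_tuple (K u r : nat) (eps : F) W Y : (0 < K)%N -> (0 < u)%N ->
    (forall i, Y i \subset W) -> (forall i, #|Y i| = (K ^ r * u)%N) -> phi Y < eps * r%:R ->
  exists s Z, [/\ (u <= s)%N, forall i, Z i \subset W, forall i, #|Z i| = (K * s)%N &
    forall Z' : 'I_t -> {set G}, (forall i, Z' i \subset W) -> (forall i, (s <= #|Z' i|)%N) ->
      phi Z - eps <= phi Z'].
Proof.
move=> K0 u0; elim: r Y => [|r IHr] Y sY cY phiY.
  by have := phi_ge0 Y; rewrite leNgt; move: phiY; rewrite mulr0 => ->.
pose P (Z : {ffun 'I_t -> {set G}}) := [&& [forall i, Z i \subset W],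
  [forall i, (K ^ r * u <= #|Z i|)%N] & phi Z < phi Y - eps].
have s0 : (0 < K ^ r * u)%N by rewrite muln_gt0 expn_gt0 K0.
case: (pickP P) => [Z /and3P[/forallP sZ /forallP cZ ltZ]|noZ].
  have [Z' [sZ' cZ' leZ']] := shrink_tuple s0 cZ.
  apply: (IHr Z') => // [i|]; first exact: subset_trans (sZ' i) (sZ i).
  by rewrite -natr1 in phiY; lra.
exists (K ^ r * u)%N, Y; split=> //; first by rewrite leq_pmull // expn_gt0 K0.
  by move=> i; rewrite cY expnS mulnA.
move=> Z sZ cZ; have := noZ [ffun i => Z i]; rewrite /P.
have -> : phi [ffun i => Z i] = phi Z by apply: eq_phi => i; rewrite ffunE.
have -> : [forall i, [ffun i => Z i] i \subset W] by apply/forallP => i; rewrite ffunE.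
have -> : [forall i, (K ^ r * u <= #|[ffun i => Z i] i|)%N].
  by apply/forallP => i; rewrite ffunE.
by move=> /= /negbT; rewrite -leNgt.
Qed.

(* [phi] is affine in each coordinate, so that a subtuple cannot have a larger
   value without its complement having a value below the minimum. *)
Lemma near_minimal_subtuple (K s : nat) (eps : F) W Y (A : 'I_t -> {set G}) :
    (0 < s)%N -> 0 <= eps ->
    (forall i, Y i \subset W) -> (forall i, #|Y i| = (K * s)%N) ->
    (forall Z : 'I_t -> {set G}, (forall i, Z i \subset W) -> (forall i, (s <= #|Z i|)%N) ->
      phi Y - eps <= phi Z) ->
    (forall i, A i \subset Y i) -> (forall i, (s <= #|A i|)%N) ->
    (forall i, (#|A i| + s <= K * s)%N) ->
  phi A <= phi Y + eps * K%:R ^+ t - eps.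
Proof.
move=> s0 e0 sY cY minY sA leA geA.
pose H n (i : 'I_t) := if (i < n)%N then A i else Y i.
have H_W n i : H n i \subset W.
  by rewrite /H; case: ifP => _ //; apply: subset_trans (sA i) (sY i).
have geY i : (s <= #|Y i|)%N by apply: leq_trans (leA i) (subset_leq_card (sA i)).
have H_s n i : (s <= #|H n i|)%N by rewrite /H; case: ifP.
(* The parts are replaced one at a time; each replacement multiplies the excess over [phi Y - eps]
   by at most [K], a bound for [#|Y k| / #|A k|]. *)
suff HP n : (n <= t)%N -> phi (H n) - phi Y + eps <= eps * K%:R ^+ n.
  have := HP t (leqnn t); rewrite (@eq_phi (H t) A); first by lra.
  by move=> i; rewrite /H ltn_ord.
elim: n => [|n IHn] lt; first by rewrite (@eq_phi (H 0) Y) // expr0; lra.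
have {IHn} IHn := IHn (ltnW lt); pose k := Ordinal lt.
have [b bE] := phi_upd (H n) k.
have Hk : H n k = Y k by rewrite /H ltnn.
have HS : phi (H n.+1) = phi (upd (H n) k (A k)).
  apply: eq_phi => i; rewrite /upd /H ltnS leq_eqVlt.
  case: (eqVneq i k) => [->|ne]; first by rewrite eqxx.
  suff -> : (i == n :> nat) = false by [].
  by apply: contra_neqF ne => /eqP e; apply: val_inj.
pose C := Y k :\: A k.
have cC : (#|C| + #|A k| = K * s)%N.
  by rewrite -(cY k) addnC -(cardsID (A k) (Y k)); have /setIidPr -> := sA k.
(* The value with [Y k] in position [k] is a weighted mean of those with [A k] and with [C], and the
   latter is not below the minimum. *)
have minC : phi Y - eps <= phi (upd (H n) k C).
  apply: minY => i; rewrite /upd; case: eqP => // _.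
    by apply: subset_trans (subsetDl _ _) (sY k).
  by have := geA k; move: cC; clear; lia.
have Y0 : (0 < #|Y k|)%N by apply: leq_trans (geY k).
have spl := avg_split (load (H n) k) (sA k) Y0.
have := phi_upd_id (H n) k; rewrite Hk.
move: HS minC; rewrite !bE => -> minC EH; rewrite -EH in IHn; move: minC IHn spl.
have c1 : #|Y k|%:R = #|C|%:R + #|A k|%:R :> F by rewrite -natrD cC cY.
have c2 : #|Y k|%:R <= K%:R * #|A k|%:R :> F.
  by rewrite cY -natrM ler_nat leq_mul2l leA orbT.
have c3 : 0 < #|A k|%:R :> F by rewrite ltr0n (leq_trans s0).
have c4 : 0 <= #|C|%:R :> F by [].
rewrite exprS c1 -/C; rewrite c1 in c2; move: c2 c3 c4.
set pK := _ ^+ n; set cA := #|A k|%:R; set cc := #|C|%:R.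
set kk := K%:R; set uA := avg (A k) _; set uY := avg (Y k) _; set uC := avg C _.
move=> c2 c3 c4 m1 m2 spl.
have n1 : 0 <= b + 2 * uY - phi Y + eps.
  rewrite EH; have := minY (H n) (H_W n) (H_s n); lra.
suff : cA * (b + 2 * uA - phi Y + eps) <= cA * (eps * (kk * pK)) by rewrite ler_pM2l.
apply: le_trans (_ : (cc + cA) * (b + 2 * uY - phi Y + eps) <= _).
  have e1 : (cc + cA) * (b + 2 * uY - phi Y + eps) =
    (cc + cA) * (b - phi Y + eps) + 2 * ((cc + cA) * uY) by ring.
  rewrite e1 spl.
  have : 0 <= cc * (b + 2 * uC - phi Y + eps) by rewrite mulr_ge0 //; lra.
  by move: m1; clear; lra.
apply: le_trans (_ : kk * cA * (eps * pK) <= _); last by lra.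
apply: ler_pM => //; lra.
Qed.

End Density.

Lemma degree_ratio (F : realFieldType) (a w T : nat) : (0 < T)%N -> (0 < w)%N ->
  (33 * (T * a) <= 32 * w)%N -> (a%:R / w%:R <= 32%:R / 33%:R / T%:R :> F)%R.
Proof.
move=> T0 w0; rewrite -(ler_nat F) !natrM => h.
rewrite ler_pdivrMr ?ltr0n // mulrAC ler_pdivlMr ?ltr0n //.
by move: h; set x := (a%:R)%R; set y := (T%:R)%R; set z := (w%:R)%R; lra.
Qed.

(** Replacing part [k] of a subtuple by all of [W] lowers [phi] by at most [eps * K ^ t = 1 / 33].
    The average load of [W] is at most [32 / 33] by the degree bound, and [phi] counts loads twice,
    so that of [A k] is at most [32 / 33 + 1 / 66]. *)
Lemma light_subtuples (F : realFieldType) t K : (1 < t)%N -> (0 < K)%N ->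
  exists M, (0 < M)%N /\ forall (G : sgraph) (W : {set G}) u, (0 < u)%N -> (M * u <= #|W|)%N ->
    (forall x, x \in W -> 33 * (t.-1 * #|nb x :&: W|) <= 32 * #|W|)%N ->
  exists s (Y : 'I_t -> {set G}), [/\ (u <= s)%N, forall i, Y i \subset W,
    forall i, #|Y i| = (K * s)%N &
    forall A : 'I_t -> {set G}, (forall i, A i \subset Y i) -> (forall i, (s <= #|A i|)%N) ->
      (forall i, (#|A i| + s <= K * s)%N) ->
      forall k, (avg (A k) (load F A k) <= 65%:R / 66%:R)%R].
Proof.
move=> t1 K0.
(* [R] rounds of descent suffice: [eps * R] exceeds [t ^ 2], the trivial bound on [phi]. *)
have [R RE] : exists R, R = (33 * K ^ t * t ^ 2).+1 by exists (33 * K ^ t * t ^ 2).+1.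
exists (K ^ R)%N.
split=> [|G W u u0 MW degW]; first by rewrite expn_gt0 K0.
have c33 : (0 < 33%:R :> F)%R by rewrite ltr0n.
have [eps epsE] : exists eps : F, eps = (1 / (33%:R * K%:R ^+ t))%R by eexists.
have Kt0 : (0 < (K%:R : F) ^+ t)%R by rewrite exprn_gt0 // ltr0n.
have e0 : (0 < eps)%R by rewrite epsE divr_gt0 ?ltr01 ?(mulr_gt0 c33 Kt0).
have [Y0 sY0 cY0] := subset_of_size MW.
have lt0 : (phi F (fun _ : 'I_t => Y0) < eps * R%:R)%R.
  apply: le_lt_trans (phi_le _ _) _.
  rewrite epsE mulrAC ltr_pdivlMr ?(mulr_gt0 c33 Kt0) // mul1r RE.
  by rewrite -natrX -!natrM ltr_nat ltnS mulnC.
have [s [Y [us sY cY minY]]] :=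
  near_minimal_tuple K0 u0 (fun=> sY0) (fun=> cY0) lt0.
have s0 : (0 < s)%N by apply: leq_trans us.
exists s, Y; split; [exact: us|exact: sY|exact: cY|move=> A sA leA geA k].
have sub := near_minimal_subtuple s0 (ltW e0) sY cY minY sA leA geA.
have [b bE] := phi_upd F A k.
have W0 : (0 < #|W|)%N by apply: leq_trans MW; rewrite muln_gt0 expn_gt0 K0.
have minW : (phi F Y - eps <= phi F (upd A k W))%R.
  have AW i : A i \subset W by apply: subset_trans (sA i) (sY i).
  apply: minY => i; rewrite /upd; case: eqP => _; [exact: subxx|exact: AW| |exact: leA].
  apply: leq_trans (leA i) (subset_leq_card _).
  by apply: subset_trans (sA i) (sY i).
have loadW : (avg W (load F A k) <= 32%:R / 33%:R)%R.
  rewrite /load avg_sum.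
  have tT : (0 < (t.-1)%:R :> F)%R by rewrite ltr0n; move: t1; clear; lia.
  apply: (@le_trans _ _ (\sum_(j | j != k) (32%:R / 33%:R / (t.-1)%:R)))%R.
    apply: ler_sum => j _; rewrite avg_adjC; apply: avg_le_const.
      by rewrite divr_ge0 ?divr_ge0 ?ler0n.
    move=> x xA; rewrite avg_adj_nb; apply: degree_ratio => [||].
    - by rewrite -(ltr0n F).
    - exact: W0.
    - by apply: degW; apply: (subsetP (sY j)); apply: (subsetP (sA j)).
  rewrite sumr_const.
  have -> : #|[pred j : 'I_t | j != k]| = t.-1.
    by have := cardC1 k; rewrite card_ord => <-; apply: eq_card => j; rewrite !inE.
  by rewrite -[X in (X <= _)%R]mulr_natr divfK ?lexx // gt_eqF.
have := phi_upd_id F A k; rewrite !bE in minW *.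
have eK : (eps * K%:R ^+ t = 1 / 33%:R)%R.
  by rewrite epsE; field; rewrite gt_eqF.
by rewrite eK in sub => idE; rewrite -idE in sub; lra.
Qed.

(** * Large degrees *)

Lemma top_subset (G : sgraph) (Z : {set G}) s (f : G -> nat) : s <= #|Z| ->
  exists X : {set G}, [/\ X \subset Z, #|X| = s &
    forall x z, x \in X -> z \in Z :\: X -> f z <= f x].
Proof.
elim: s => [|s IHs] leZ.
  by exists set0; rewrite sub0set cards0; split=> // x z; rewrite inE.
have [X [sX cX topX]] := IHs (ltnW leZ).
have [x0 x0Z] : exists x, x \in Z :\: X.
  apply/set0Pn; rewrite -card_gt0; have := cardsID X Z.
  by have /setIidPr -> := sX; move: leZ; rewrite cX; clear; lia.
case: (arg_maxnP f x0Z) => x xZ maxx; have {}xZ : x \in Z :\: X := xZ.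
have /setDP[xZ' xX] := xZ.
exists (x |: X); split.
- by rewrite subUset sub1set xZ'.
- by rewrite cardsU1 xX cX.
move=> y z; rewrite !inE negb_or -andbA => yX /and3P[zx zX zZ].
have zZX : z \in Z :\: X by rewrite inE zX.
by case/orP: yX => [/eqP ->|yX]; [apply: maxx | apply: topX].
Qed.

(** [X] and [X'] consist of the [s] vertices of [Z i] and [Z j] with most neighbours in [Z k]. The
    tuple having them as parts still has average load at most [65 / 66] at [k], and a vertex left
    outside sees no more of [Z k] than any inside. *)
Lemma light_pair (F : realFieldType) (G : sgraph) t (Z : 'I_t -> {set G}) s K
    (i j k : 'I_t) :
    0 < s -> (forall l, s <= #|Z l|) -> (forall l, #|Z l| + s <= K * s) ->
    (forall A : 'I_t -> {set G}, (forall l, A l \subset Z l) -> (forall l, s <= #|A l|) ->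
      (forall l, #|A l| + s <= K * s) -> (avg (A k) (load F A k) <= 65%:R / 66%:R)%R) ->
    i != j -> i != k -> j != k ->
  exists X X' : {set G}, [/\ #|X| <= s, #|X'| <= s & forall c c',
    c \in Z i :\: X -> c' \in Z j :\: X' ->
    66 * (#|nb c :&: Z k| + #|nb c' :&: Z k|) <= 65 * #|Z k|].
Proof.
move=> s0 leZ geZ light ij ik jk; pose f x := #|nb x :&: Z k|.
have [X [sX cX topX]] := top_subset f (leZ i).
have [X' [sX' cX' topX']] := top_subset f (leZ j).
exists X, X'; rewrite cX cX'; split=> // c c' cZ cZ'.
pose A := upd (upd Z i X) j X'.
have Ai : A i = X by rewrite /A /upd (negbTE ij) eqxx.
have Aj : A j = X' by rewrite /A /upd eqxx.
have Ak : A k = Z k by rewrite /A /upd !(eq_sym k) (negbTE ik) (negbTE jk).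
have AE l : [/\ A l \subset Z l, s <= #|A l| & #|A l| + s <= K * s].
  have ss : s + s <= K * s by apply: leq_trans (geZ i); rewrite leq_add2r.
  rewrite /A /upd; case: (eqVneq l j) => [->|_]; first by rewrite sX' cX'.
  by case: (eqVneq l i) => [->|_]; [rewrite sX cX | split].
have := light A (fun l => let: And3 h _ _ := AE l in h)
  (fun l => let: And3 _ h _ := AE l in h) (fun l => let: And3 _ _ h := AE l in h).
rewrite /load avg_sum (bigD1 i) //= (bigD1 j) ?jk 1?eq_sym //= Ai Aj Ak.
set rest := (\sum_(_ | _) _)%R.
have rest0 : (0 <= rest)%R.
  by apply: sumr_ge0 => l _; apply: avg_ge0 => x _; apply: avg_ge0.
have w0 : 0 < #|Z k| by apply: leq_trans (leZ k).
have low (B : {set G}) y : #|B| = s -> (forall x, x \in B -> f y <= f x) ->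
   ((f y)%:R / #|Z k|%:R <= avg (Z k) (fun x => avg B (fun z => (adj x z)%:R)) :> F)%R.
  move=> cB leB; rewrite avg_adjC; apply: avg_ge_const; first by rewrite cB.
  by move=> x xB; rewrite avg_adj_nb ler_pM2r ?invr_gt0 ?ltr0n // ler_nat leB.
have l1 := low X c cX (fun x xX => topX x c xX cZ).
have l2 := low X' c' cX' (fun x xX => topX' x c' xX cZ').
move=> le65; have : (((f c + f c')%N%:R : F) / #|Z k|%:R <= 65%:R / 66%:R)%R.
  rewrite natrD mulrDl; apply: le_trans le65; rewrite addrA -[X in (X <= _)%R]addr0.
  by rewrite lerD // lerD.
rewrite ler_pdivrMr ?ltr0n // mulrAC ler_pdivlMr ?ltr0n // -!natrM ler_nat.
by rewrite mulnC.
Qed.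

(** The parts of an almost minimal tuple may overlap; each is large enough to avoid the subsets
    chosen before. *)
Lemma disjoint_subfamily (G : sgraph) (Y : nat -> {set G}) n w :
    (forall i, i < n -> n * w <= #|Y i|) ->
  exists P : nat -> {set G},
    (forall i, i < n -> P i \subset Y i /\ #|P i| = w) /\
    (forall i j, i < n -> j < n -> i != j -> [disjoint P i & P j]).
Proof.
move=> leY; suff H k : k <= n -> exists P : nat -> {set G},
    (forall i, i < k -> P i \subset Y i /\ #|P i| = w) /\
    (forall i j, i < k -> j < k -> i != j -> [disjoint P i & P j]).
  exact: H n (leqnn n).
elim: k => [|k IHk] ltk; first by exists (fun _ => set0).
have [P [P1 P2]] := IHk (ltnW ltk).
pose U := \bigcup_(i < k) P i.
have cU : #|U| <= k * w.
  by apply: card_bigcup_le => i; have [_ ->] := P1 i (ltn_ord i).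
have [|B sB cB] := @subset_of_size G w (Y k :\: U).
  have := leY k ltk; have := cardsID U (Y k).
  have : #|Y k :&: U| <= #|U| by apply/subset_leq_card/subsetIr.
  have : k.+1 * w <= n * w by rewrite leq_mul2r ltk orbT.
  by rewrite mulSn; move: cU; clear; lia.
have dB i : i < k -> [disjoint P i & B].
  move=> ik; apply: disjointI => x xP /(subsetP sB)/setDP[_ /negP[]].
  by apply/bigcupP; exists (Ordinal ik).
exists (fun i => if i == k then B else P i); split=> [i|i j].
  case: eqP => [->|ne] li; first by split=> //; apply: subset_trans sB (subsetDl _ _).
  by apply: P1; move: ne li; clear; lia.
case: (eqVneq i k) => [->|ik]; case: (eqVneq j k) => [->|jk] // li lj ne.
- by rewrite disjoint_sym; apply: dB; move: lj jk; clear; lia.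
- by apply: dB; move: li ik; clear; lia.
- by apply: P2 => //; move: li lj ik jk; clear; lia.
Qed.

(** * Successive choice of branch vertices and connecting edges *)

Section Picking.
Variables (G : sgraph) (m t s c : nat) (Y : nat -> {set G}).
Hypothesis coh : coherent G m.
Hypotheses (t3 : 2 < t) (m0 : 0 < m) (ms : m <= s).
Hypothesis c2 : 66 <= c.
Hypothesis disY : forall i j, i < t -> j < t -> i != j -> [disjoint Y i & Y j].

(** [n] counts the choices still to be made: each may shrink a set by a factor [c], and [4 * t * s]
    vertices must survive them all. *)
Definition roomy n (Z : nat -> {set G}) :=
  forall i, i < t -> Z i \subset Y i /\ c ^ n * (4 * t * s) <= #|Z i|.

Hypothesis light : forall n Z, roomy n Z -> forall i j k, i < t -> j < t -> k < t ->
  i != j -> i != k -> j != k ->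
  exists X X' : {set G}, [/\ #|X| <= s, #|X'| <= s & forall a b,
    a \in Z i :\: X -> b \in Z j :\: X' ->
    66 * (#|nb a :&: Z k| + #|nb b :&: Z k|) <= 65 * #|Z k|].

Hypothesis dense : forall Z : {set G}, (exists2 i, i < t & Z \subset Y i) -> s <= #|Z| ->
  exists2 z, z \in Z & 2 * #|Z| <= c * #|nb z :&: Z|.

Lemma roomy_card n Z i : roomy n Z -> i < t -> 4 * (t * s) <= #|Z i|.
Proof.
move=> /[apply] -[_]; apply: leq_trans; rewrite -mulnA leq_pmull // expn_gt0.
by rewrite (leq_trans _ c2).
Qed.

Lemma card_ge_quotient n (Z Z' : {set G}) :
  c ^ n.+1 * (4 * t * s) <= #|Z| -> #|Z| <= c * #|Z'| -> c ^ n * (4 * t * s) <= #|Z'|.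
Proof.
move=> h1 h2; have c0 : 0 < c by rewrite (leq_trans _ c2).
by rewrite -(leq_pmul2l c0); apply: leq_trans h2; rewrite mulnA -expnS.
Qed.

Lemma card_nonneighbours (Z A : {set G}) a :
  A \subset Z -> 66 * a <= 65 * #|Z| -> #|A| <= a -> #|Z| <= c * #|Z :\: A|.
Proof.
move=> sA h1 h2; apply: leq_trans (_ : 66 * #|Z :\: A| <= _); last by rewrite leq_mul2r c2 orbT.
by have := cardsID A Z; have /setIidPr -> := sA; move: h1 h2; clear; lia.
Qed.


(** A new branch vertex has many neighbours in its own set and is not adjacent to most of any other.
    Its own set is then restricted to its neighbours, the others to its nonneighbours. *)
Lemma pick_branch_vertices N Z0 n : roomy (t + N) Z0 -> n <= t ->
  exists (v : nat -> G) Z, [/\ roomy (t - n + N) Z,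
    forall i, i < n -> v i \in Y i,
    forall i x, i < n -> x \in Z i -> adj (v i) x &
    forall i k, i < n -> k < t -> i != k ->
      (forall x, x \in Z k -> ~~ adj (v i) x) /\ (i < k < n -> ~~ adj (v i) (v k))].
Proof.
move=> rZ0; elim: n => [|n IHn] nt.
  have [z0 _] : exists z, z \in Z0 0.
    apply/set0Pn; rewrite -card_gt0; apply: leq_trans (roomy_card rZ0 _).
      by rewrite !muln_gt0 (leq_trans m0 ms) (leq_trans _ t3).
    exact: leq_trans t3.
  by exists (fun _ => z0), Z0; rewrite subn0; split.
have [v [Z1 [rZ1 vY adj1 nadj1]]] := IHn (ltnW nt).
pose M := t - n.+1 + N.
have {}rZ1 : roomy M.+1 Z1 by rewrite /M -addSn -subSn.
have big i : i < t -> 4 * (t * s) <= #|Z1 i| by apply: roomy_card rZ1.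
have s0 : 0 < s := leq_trans m0 ms.
have sts : s <= t * s by rewrite leq_pmull // (leq_trans _ t3).
have /fin_all_exists[X XP] (k : 'I_t) : exists X : {set G}, #|X| <= s /\
    (n != k -> forall a, a \in Z1 n :\: X -> 66 * #|nb a :&: Z1 k| <= 65 * #|Z1 k|).
  case: (eqVneq n k) => [nk|nk]; first by exists set0; rewrite cards0.
  (* Lightness speaks of pairs of vertices, so bounding what one vertex sees of [Z k] takes a third
     index; one of [0], [1], [2] serves, as [t] is at least three. *)
  have [j [jt nj jk]] : exists j, [/\ j < t, n != j & j != k].
    have [j lj] : exists j, [/\ j < 3, n != j & j != k].
      case: (boolP ((n != 0) && (0 != k :> nat))) => [/andP[]|h0]; first by exists 0.
      case: (boolP ((n != 1) && (1 != k :> nat))) => [/andP[]|h1]; first by exists 1.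
      by exists 2; split=> //; move: h0 h1 nk; clear; move: (k : nat) => k'; lia.
    by exists j; case: lj => lj nj jk; split=> //; apply: leq_trans lj t3.
  have [X [X' [cX cX' lX]]] := light rZ1 nt jt (ltn_ord k) nj nk jk.
  have [b bZ] : exists b, b \in Z1 j :\: X'.
    apply/set0Pn; rewrite -card_gt0; have := cardsID X' (Z1 j).
    have : #|Z1 j :&: X'| <= #|X'| by apply/subset_leq_card/subsetIr.
    by have := big j jt; move: cX' s0 sts; clear; lia.
  exists X; split=> // _ a aZ; apply: leq_trans (lX a b aZ bZ).
  by rewrite leq_mul2l leq_addr.
pose U := \bigcup_(k < t) X k.
have cU : #|U| <= t * s by apply: card_bigcup_le => k; have [] := XP k.
pose Z' := Z1 n :\: U.
have cZ' : #|Z1 n| <= 2 * #|Z'| /\ s <= #|Z'|.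
  have := cardsID U (Z1 n); have : #|Z1 n :&: U| <= #|U| by apply/subset_leq_card/subsetIr.
  by have := big n nt; rewrite -/Z'; move: cU sts; clear; lia.
have [sZ1 _] := rZ1 n nt.
have sZ' : Z' \subset Z1 n by apply: subsetDl.
have [|w wZ' wd] := dense _ cZ'.2; first by exists n => //; apply: subset_trans sZ' sZ1.
have wZ1 : w \in Z1 n := subsetP sZ' _ wZ'.
pose Z2 k := if k == n then nb w :&: Z' else Z1 k :\: (nb w :&: Z1 k).
have wX (k : 'I_t) : n != k -> 66 * #|nb w :&: Z1 k| <= 65 * #|Z1 k|.
  move=> nk; have [_ /(_ nk)] := XP k; apply; rewrite inE wZ1 andbT.
  by case/setDP: wZ' => _; apply: contra => wX; apply/bigcupP; exists k.
have Z2n : Z2 n = nb w :&: Z' by rewrite /Z2 eqxx.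
have Z2o k : k != n -> Z2 k = Z1 k :\: (nb w :&: Z1 k) by move=> /negbTE e; rewrite /Z2 e.
have Z2s k : Z2 k \subset Z1 k.
  rewrite /Z2; case: eqP => [->|_]; last exact: subsetDl.
  by apply: subset_trans (subsetIr _ _) sZ'.
pose v2 i := if i == n then w else v i.
have v2n : v2 n = w by rewrite /v2 eqxx.
have v2o i : i < n -> v2 i = v i by move=> li; rewrite /v2 ifN //; move: li; clear; lia.
have dec i : i < n.+1 -> i = n \/ i < n by clear; lia.
exists v2, Z2; split.
- move=> i it; have [sY cZ1] := rZ1 i it; split; first exact: subset_trans (Z2s i) sY.
  apply: card_ge_quotient cZ1 _; case: (eqVneq i n) => [->|ni].
    by rewrite Z2n; apply: leq_trans cZ'.1 wd.
  rewrite Z2o //; apply: (@card_nonneighbours _ _ #|nb w :&: Z1 i|) => //.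
    exact: subsetIr.
  by apply: (wX (Ordinal it)); rewrite eq_sym.
- move=> i /dec[->|li]; last by rewrite v2o //; apply: vY.
  by rewrite v2n (subsetP sZ1).
- move=> i x /dec[->|li]; first by rewrite v2n Z2n !inE => /andP[].
  by move=> /(subsetP (Z2s i)); rewrite v2o //; apply: adj1.
move=> i k /dec[->|li] kt ik.
  rewrite v2n Z2o 1?eq_sym //; split; last by clear; lia.
  by move=> x; rewrite !inE => /andP[+ xZ]; rewrite xZ andbT.
have [h1 h2] := nadj1 i k li kt ik; rewrite v2o //; split.
  by move=> x /(subsetP (Z2s k)); apply: h1.
case/andP=> lik /dec[ek|lk].
  by rewrite ek v2n; apply: h1; rewrite ek.
by rewrite v2o //; apply: h2; rewrite lik.
Qed.

Definition picked (r : seq (nat * nat)) (Z0 Z : nat -> {set G}) (Q : nat -> nat -> {set G}) :=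
  [/\ forall k, k < t -> Z k \subset Z0 k,
      forall i j : nat, (i, j) \in r -> exists a b,
        [/\ Q i j = [set a; b], a \in Z0 i, b \in Z0 j & adj a b],
      forall i j : nat, (i, j) \in r -> forall x, x \in Q i j -> forall k, k < t ->
        x \notin Z k /\ (k != i -> k != j -> forall z, z \in Z k -> ~~ adj x z) &
      forall i j k l : nat, (i, j) \in r -> (k, l) \in r -> (i, j) != (k, l) ->
        [disjoint Q i j & Q k l] /\
        ([&& i != k, i != l, j != k & j != l] ->
          forall x y, x \in Q i j -> y \in Q k l -> ~~ adj x y)].

(** Once the exceptional vertices for every [k] are removed, coherence gives an edge between the
    rest of [Z i] and of [Z j]; its ends together see at most [65 / 66] of any other set. *)
Lemma pick_edges N Z0 r : roomy N Z0 -> uniq r -> (forall p, p \in r -> p.1 < p.2 < t) ->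
    size r <= N ->
  exists Z Q, roomy (N - size r) Z /\ picked r Z0 Z Q.
Proof.
move=> rZ0; elim: r => [|[i j] r IHr] /=.
  by move=> _ _ _; exists Z0, (fun _ _ => set0); rewrite subn0; split.
case/andP=> ijr ur ltr szr.
have lts (x y : nat) : (x, y) \in r -> x < y < t.
  by move=> h; have := ltr (x, y); rewrite inE h orbT; apply.
have [||Z1 [Q [rZ1 [sZ1 Q1 Q2 Q3]]]] := IHr ur.
- by move=> [x y] /lts.
- exact: ltnW.
pose M := N - (size r).+1.
have {}rZ1 : roomy M.+1 Z1 by rewrite /M -subSn.
have := ltr (i, j); rewrite inE eqxx /= => /(_ isT) ltij.
have it : i < t by move: ltij; clear; lia.
have jt : j < t by move: ltij; clear; lia.
have ij : i != j by move: ltij; clear; lia.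
have big k : k < t -> 4 * (t * s) <= #|Z1 k| by apply: roomy_card rZ1.
have s0 : 0 < s := leq_trans m0 ms.
have sts : s <= t * s by rewrite leq_pmull // (leq_trans _ t3).
have exX (k : 'I_t) : exists XX : {set G} * {set G}, [/\ #|XX.1| <= s, #|XX.2| <= s &
    i != k -> j != k -> forall a b, a \in Z1 i :\: XX.1 -> b \in Z1 j :\: XX.2 ->
      66 * (#|nb a :&: Z1 k| + #|nb b :&: Z1 k|) <= 65 * #|Z1 k|].
  case: (eqVneq i k) => [ik|ik]; first by exists (set0, set0); rewrite cards0.
  case: (eqVneq j k) => [jk|jk]; first by exists (set0, set0); rewrite cards0.
  have [X [X' [cX cX' lX]]] := light rZ1 it jt (ltn_ord k) ij ik jk.
  by exists (X, X').
have /fin_all_exists[X XP] := exX.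
pose U := \bigcup_(k < t) (X k).1; pose U' := \bigcup_(k < t) (X k).2.
have cU : #|U| <= t * s by apply: card_bigcup_le => k; have [] := XP k.
have cU' : #|U'| <= t * s by apply: card_bigcup_le => k; have [] := XP k.
have room k (V : {set G}) : k < t -> #|V| <= t * s -> 2 * m <= #|Z1 k :\: V|.
  move=> kt cV; have := cardsID V (Z1 k).
  have : #|Z1 k :&: V| <= #|V| by apply/subset_leq_card/subsetIr.
  by have := big k kt; move: cV sts ms; clear; lia.
have [a [b [aZ bZ ab]]] := coherent_edge coh (room i U it cU) (room j U' jt cU').
have /setDP[aZ1 aU] := aZ; have /setDP[bZ1 bU] := bZ.
have lightab k : k < t -> i != k -> j != k ->
    66 * (#|nb a :&: Z1 k| + #|nb b :&: Z1 k|) <= 65 * #|Z1 k|.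
  move=> kt ik jk; have [_ _ /(_ ik jk)] := XP (Ordinal kt); apply; rewrite inE.
    rewrite aZ1 andbT; apply: contra aU => h.
    by apply/bigcupP; exists (Ordinal kt).
  rewrite bZ1 andbT; apply: contra bU => h.
  by apply/bigcupP; exists (Ordinal kt).
(* In the sets of its own two indices the edge only loses its ends: later edges there belong to
   pairs meeting [(i, j)] and may be adjacent to it. *)
pose Z2 k := if (i == k) || (j == k) then Z1 k :\: [set a; b]
             else Z1 k :\: ((nb a :|: nb b) :&: Z1 k).
have Z2s k : Z2 k \subset Z1 k by rewrite /Z2; case: ifP => _; apply: subsetDl.
pose Q' x y := if (x, y) == (i, j) then [set a; b] else Q x y.
have Q'n : Q' i j = [set a; b] by rewrite /Q' eqxx.
have Q'o (x y : nat) : (x, y) \in r -> Q' x y = Q x y.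
  by move=> h; rewrite /Q' ifN //; apply: contraNneq ijr => <-.
have Yab k : k < t -> [/\ k != i -> a \notin Z1 k & k != j -> b \notin Z1 k].
  have aux k' x : k' < t -> k < t -> x \in Z1 k' -> k != k' -> x \notin Z1 k.
    move=> kt' kt xZ kk; apply/negP => xZ'.
    have [/subsetP s1 _] := rZ1 _ kt'; have [/subsetP s2 _] := rZ1 _ kt.
    by have /disjointFr/(_ (s2 _ xZ')) := disY kt kt' kk; rewrite s1.
  by move=> kt; split=> h; [apply: (aux i) | apply: (aux j)].
exists Z2, Q'; split; last split.
- move=> k kt; have [sY cZ1] := rZ1 k kt; split; first exact: subset_trans (Z2s k) sY.
  apply: card_ge_quotient cZ1 _; rewrite /Z2; case: ifPn => [_|].
    apply: leq_trans (_ : 2 * #|Z1 k :\: [set a; b]| <= _).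
      have := cardsID [set a; b] (Z1 k).
      have : #|Z1 k :&: [set a; b]| <= 2.
        apply: leq_trans (subset_leq_card (subsetIr _ _)) _.
        by rewrite cards2; case: (a != b).
      have : 4 <= #|Z1 k|.
        by apply: leq_trans (big k kt); rewrite leq_pmulr // muln_gt0 s0 (leq_trans _ t3).
      by clear; lia.
    by rewrite leq_mul2r (leq_trans _ c2) ?orbT.
  rewrite negb_or => /andP[ik jk].
  apply: (@card_nonneighbours _ _ (#|nb a :&: Z1 k| + #|nb b :&: Z1 k|)).
  + exact: subsetIr.
  + exact: lightab.
  + by rewrite setIUl leq_card_setU.
- by move=> k kt; apply: subset_trans (Z2s k) (sZ1 k kt).
- move=> x y; rewrite inE => /predU1P[[-> ->]|h]; last by rewrite Q'o //; apply: Q1.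
  exists a, b; split=> //; [exact: (subsetP (sZ1 i it)) | exact: (subsetP (sZ1 j jt))].
- move=> x y; rewrite inE => /predU1P[[-> ->]|h]; last first.
    move=> z; rewrite Q'o // => zQ k kt; have [n1 n2] := Q2 _ _ h z zQ k kt.
    split; first by apply: contra n1; apply: (subsetP (Z2s k)).
    by move=> kx ky w /(subsetP (Z2s k)); apply: n2.
  rewrite Q'n => z zab k kt; split; last first.
    move=> ki kj w; rewrite /Z2 !(eq_sym _ k) (negbTE ki) (negbTE kj) /= !inE.
    case/andP=> + wZ; rewrite wZ andbT negb_or => /andP[na nb_].
    by move: zab; rewrite !inE => /orP[]/eqP->.
  rewrite /Z2; case: ifPn => [_|]; first by rewrite inE zab.
  rewrite negb_or !(eq_sym _ k) => /andP[ki kj]; have [na nb_] := Yab k kt.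
  apply: contra (_ : z \notin Z1 k) => [/setDP[]//|].
  by move: zab; rewrite !inE => /orP[]/eqP->; [apply: na | apply: nb_].
- have new (x y : nat) : (x, y) \in r -> [disjoint [set a; b] & Q x y] /\
    ([&& i != x, i != y, j != x & j != y] ->
      forall u w, u \in [set a; b] -> w \in Q x y -> ~~ adj u w).
    move=> h; split.
      apply: disjointI => z zab zQ; move: zab; rewrite !inE => /orP[]/eqP e.
        by have [] := Q2 _ _ h z zQ i it; rewrite e aZ1.
      by have [] := Q2 _ _ h z zQ j jt; rewrite e bZ1.
    case/and4P=> ix iy jx jy u w; rewrite !inE => uab wQ; rewrite adj_sym.
    case/orP: uab => /eqP->.
      by have [_ /(_ ix iy)] := Q2 _ _ h w wQ i it; apply.
    by have [_ /(_ jx jy)] := Q2 _ _ h w wQ j jt; apply.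
  move=> x y x' y'; rewrite !inE => /predU1P[[-> ->]|h] /predU1P[[-> ->]|h'] ne.
  + by rewrite eqxx in ne.
  + by rewrite Q'n Q'o //; apply: new.
  + rewrite Q'n Q'o //; have [dis ac] := new _ _ h; rewrite disjoint_sym; split=> //.
    case/and4P=> n1 n2 n3 n4 u w uQ wab; rewrite adj_sym; apply: ac => //.
    by rewrite !(eq_sym i) !(eq_sym j) n1 n2 n3 n4.
  + by rewrite !Q'o //; apply: Q3.
Qed.

(** The budget pays for [t] branch vertices and at most [t ^ 2] edges [a b]; the paths are [v i],
    [a], [b], [v j]. *)
Lemma pick_weakly_linked Z0 : roomy (t + t ^ 2) Z0 -> weakly_linked G t.
Proof.
move=> rZ0; have [v [Z1 [rZ1 vY adj1 nadj1]]] := pick_branch_vertices rZ0 (leqnn t).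
rewrite subnn add0n in rZ1.
pose r := [seq p <- [seq (i, j) | i <- iota 0 t, j <- iota 0 t] | p.1 < p.2].
have inr (i j : nat) : i < j < t -> (i, j) \in r.
  move=> ij; rewrite mem_filter /=; apply/andP; split; first by move: ij; clear; lia.
  by apply/allpairsP; exists (i, j); rewrite !mem_iota /=; split=> //; move: ij; clear; lia.
have [|||Z [Q [_ [_ Q1 Q2 Q3]]]] := @pick_edges (t ^ 2) Z1 r rZ1.
- apply: filter_uniq; apply: allpairs_uniq; rewrite ?iota_uniq //.
  by move=> [? ?] [? ?] _ _ [-> ->].
- move=> [i j]; rewrite mem_filter => /andP[/= ij /allpairsP[[x y] /= [_ yt [_ ej]]]].
  by move: yt; rewrite mem_iota add0n -ej /= ij.
- apply: leq_trans (leq_trans (count_size _ _) _); first by rewrite size_filter.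
  by rewrite size_allpairs size_iota.
have Z1Y i : i < t -> Z1 i \subset Y i by move=> /rZ1[].
have ltt i j : i < j < t -> [/\ i < t, j < t, i != j & j != i] by split; lia.
exists v, Q; split.
- move=> i j ij; have [it jt ne _] := ltt i j ij.
  have [_ /(_ ij)] := nadj1 i j it jt ne; split=> //.
  apply/eqP => vij; have /disjointFr/(_ (vY i it)) := disY it jt ne.
  by rewrite vij vY.
- move=> i j ij; have [it jt ne _] := ltt i j ij.
  have [a [b [-> aZ bZ ab]]] := Q1 _ _ (inr _ _ ij).
  apply: (@connect_trans _ _ a).
    by apply: connect1; rewrite /radj /= !inE !eqxx !orbT; apply: adj1.
  apply: (@connect_trans _ _ b).
    by apply: connect1; rewrite /radj /= !inE !eqxx !orbT.
  apply: connect1; rewrite /radj /= !inE !eqxx !orbT /= adj_sym; exact: adj1.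
- move=> i j k ij kt; have [it jt ne _] := ltt i j ij.
  have [a [b [-> aZ bZ ab]]] := Q1 _ _ (inr _ _ ij).
  have vZ l x : l < t -> x \in Z1 l -> v k != x.
    move=> lt xZ; apply/eqP => vx; case: (eqVneq k l) => [kl|kl].
      by have := adj1 _ _ lt xZ; rewrite -kl vx adj_irr.
    have /disjointFr/(_ (vY k kt)) := disY kt lt kl.
    by rewrite vx (subsetP (Z1Y l lt)).
  split; first by rewrite !inE negb_or (vZ i) ?(vZ j).
  move=> ki kj x; rewrite !inE => /orP[]/eqP->.
    by have [h _] := nadj1 k i kt it ki; apply: h.
  by have [h _] := nadj1 k j kt jt kj; apply: h.
- by move=> i j k l ij kl; apply: Q3; apply: inr.
Qed.

End Picking.

Lemma dense_weakly_linked t E : 2 < t -> 0 < E ->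
  exists M, 0 < M /\ forall (G : sgraph) m (W : {set G}), 0 < m -> coherent G m ->
    M * m <= #|W| ->
    (forall x, x \in W -> 33 * (t.-1 * #|nb x :&: W|) <= 32 * #|W|) ->
    (forall Z : {set G}, Z \subset W -> #|W| <= M * #|Z| ->
       exists2 z, z \in Z & #|Z| <= E * #|nb z :&: Z|) ->
  weakly_linked G t.
Proof.
(* [c] must be at least [66] for the unseen part of a set and at least [2 * E] for the neighbours of
   a branch vertex. *)
move=> t3 E0; have [c cE] : exists c, c = 66 * E by eexists.
have c2 : 66 <= c by rewrite cE leq_pmulr.
have c0 : 0 < c by apply: leq_trans c2.
have t0 : 0 < t by apply: leq_trans t3.
have q0 : 0 < c ^ (t + t ^ 2) by rewrite expn_gt0 c0.
(* Parts of size [p * s] allow [t + t ^ 2] choices, and [K = t * p] leaves room for disjoint subsets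
   of that size. *)
have [p pE] : exists p, p = c ^ (t + t ^ 2) * (4 * t) by eexists.
have p0 : 0 < p by rewrite pE muln_gt0 q0 muln_gt0 t0.
have [K KE] : exists K, K = t * p by eexists.
have K0 : 0 < K by rewrite KE muln_gt0 t0 p0.
have t1 : 1 < t by apply: ltn_trans t3.
have [M0 [M00 HM0]] := light_subtuples rat t1 K0.
exists (2 * M0); split=> [|G m W m0 coh mW degW denW]; first by rewrite muln_gt0.
pose u := #|W| %/ M0.
have mu : m <= u by rewrite leq_divRL // mulnC (leq_trans _ mW) // -mulnA leq_pmull.
have u0 : 0 < u := leq_trans m0 mu.
have uW : M0 * u <= #|W| by rewrite mulnC leq_divM.
have Wu : #|W| <= 2 * M0 * u.
  have := ltn_ceil #|W| M00; rewrite -/u mulSn => h.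
  have : M0 <= M0 * u by rewrite leq_pmulr.
  by move: h; rewrite -mulnA (mulnC u); set x := M0 * u; clear; lia.
have [s [Y [us sY cY lightY]]] := HM0 G W u u0 uW degW.
have s0 : 0 < s := leq_trans u0 us.
have [i0 _] : exists i0 : 'I_t, true by exists (Ordinal (ltn_trans (ltnSn 1) t3)).
pose Yn i := if insub i is Some i' then Y i' else set0.
have YnE (i : 'I_t) : Yn i = Y i by rewrite /Yn valK.
have [|P [P1 P2]] := @disjoint_subfamily G Yn t (p * s).
  by move=> i it; rewrite -[i]/(val (Ordinal it)) YnE cY KE mulnA.
have PY (i : 'I_t) : P i \subset Y i by have [] := P1 i (ltn_ord i); rewrite YnE.
have PK (i : 'I_t) (A : {set G}) : A \subset P i -> #|A| + s <= K * s.
  move=> /subset_leq_card; have [_ ->] := P1 i (ltn_ord i) => h.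
  apply: leq_trans (_ : p * s + p * s <= _).
    by rewrite leq_add // leq_pmull.
  by rewrite addnn -mul2n mulnA leq_mul2r KE leq_mul2r t1 !orbT.
apply: (@pick_weakly_linked G m t s c P coh t3 m0 (leq_trans mu us) c2 P2 _ _ P).
- move=> n Z rZ i j k it jt kt ij ik jk.
  have sZ (l : 'I_t) : Z l \subset P l by have [] := rZ l (ltn_ord l).
  have leZ (l : 'I_t) : s <= #|Z l|.
    have [_ h] := rZ l (ltn_ord l); apply: leq_trans h.
    rewrite mulnA; apply: leq_pmull; rewrite muln_gt0 expn_gt0 c0 /=.
    by rewrite muln_gt0 t0.
  have geZ (l : 'I_t) : #|Z l| + s <= K * s by apply: PK (sZ l).
  have lightZ (A : 'I_t -> {set G}) : (forall l : 'I_t, A l \subset Z l) ->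
      (forall l, s <= #|A l|) -> (forall l, #|A l| + s <= K * s) ->
      (avg (A (Ordinal kt)) (load rat A (Ordinal kt)) <= 65%:R / 66%:R)%R.
    move=> sA leA geA; apply: lightY leA geA _ => l.
    exact: subset_trans (sA l) (subset_trans (sZ l) (PY l)).
  exact: (@light_pair rat G t (fun l : 'I_t => Z l) s K (Ordinal it) (Ordinal jt)
    (Ordinal kt) s0 leZ geZ lightZ ij ik jk).
- move=> Z [i it sZ] leZ.
  have [||z zZ zd] := denW Z.
  + by apply: subset_trans sZ _; apply: subset_trans (PY (Ordinal it)) (sY _).
  + by apply: leq_trans Wu _; rewrite leq_mul2l (leq_trans us leZ) orbT.
  exists z => //; apply: leq_trans (_ : 2 * (E * #|nb z :&: Z|) <= _).
    by rewrite leq_mul2l zd.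
  by rewrite cE -mulnA leq_mul2r orbT.
- move=> i it; have [_ ->] := P1 i it; split=> //.
  by rewrite pE mulnA.
Qed.

(** * Deleting vertices of high degree *)

Section DegreeSum.
Variable G : sgraph.
Implicit Types (x y z : G) (A B W Z : {set G}).

Definition dsum W := \sum_(x in W) \sum_(y in W) adj x y.

Lemma card_nbI x W : #|nb x :&: W| = \sum_(y in W) adj x y.
Proof.
rewrite -sum1_card big_mkcond [RHS]big_mkcond; apply: eq_bigr => y _.
by rewrite !inE andbC; case: (y \in W); case: (adj x y).
Qed.

Lemma dsumD1 x W : x \in W -> dsum W = dsum (W :\ x) + 2 * #|nb x :&: W|.
Proof.
move=> xW; rewrite card_nbI /dsum (big_setD1 x) //=.
have E y : \sum_(z in W) adj y z = adj y x + \sum_(z in W :\ x) adj y z.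
  by rewrite (big_setD1 x).
under [X in _ + X = _]eq_bigr do rewrite E.
rewrite big_split /= E adj_irr add0n.
have -> : \sum_(y in W :\ x) (adj y x : nat) = \sum_(y in W :\ x) adj x y.
  by apply: eq_bigr => y _; rewrite adj_sym.
set a := \sum_(y in W :\ x) adj x y; set b := \sum_(y in W :\ x) \sum_(z in _) _; clear; lia.
Qed.

(** Deleting a vertex whose degree times [a] is at least [b] lowers [a * dsum] by at least [2 * b],
    as its edges count from both ends. *)
Lemma delete_high_degree W0 a b : exists W, [/\ W \subset W0,
  forall x, x \in W -> a * #|nb x :&: W| < b &
  a * dsum W + 2 * b * #|W0 :\: W| <= a * dsum W0].
Proof.
move: {2}#|W0| (leqnn #|W0|) => n; elim: n W0 => [|n IHn] W0 leW.
  move: leW; rewrite leqn0 cards_eq0 => /eqP ->; exists set0; split=> //.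
    by move=> x; rewrite inE.
  by rewrite setD0 cards0 muln0 addn0.
case: (pickP (fun x => (x \in W0) && (b <= a * #|nb x :&: W0|))) => [x /andP[xW bx]|low].
  have cW := cardsD1 x W0; rewrite xW in cW.
  have [|W [sW degW sumW]] := IHn (W0 :\ x); first by move: leW cW; clear; lia.
  exists W; split=> //; first by apply: subset_trans sW (subsetDl _ _).
  have -> : #|W0 :\: W| = #|(W0 :\ x) :\: W| + 1.
    rewrite (cardsD1 x (W0 :\: W)) inE xW andbT.
    have -> : x \notin W by apply/negP => /(subsetP sW); rewrite !inE eqxx.
    by rewrite addnC; congr (#|pred_of_set _| + 1); apply/setP => y; rewrite !inE andbCA.
  rewrite (dsumD1 xW) mulnDr mulnDr muln1 addnA leq_add //.
  by rewrite mulnCA leq_mul2l bx.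
exists W0; split=> //; last by rewrite setDv cards0 muln0 addn0.
by move=> x xW; have := low x; rewrite xW /= => /negbT; rewrite -ltnNge.
Qed.

(** First delete vertices of degree at least [n / (2 * T)]. If many edges remain, the deletion was
    cheap enough to leave more than half of the vertices with a margin; otherwise a second deletion
    with an eightfold smaller threshold costs at most [n / 8] vertices. *)
Lemma low_degree_subset T : 0 < T -> 2 * T * dsum [set: G] <= #|G| ^ 2 ->
  exists W, #|G| <= 4 * #|W| /\
    forall x, x \in W -> 33 * (T * #|nb x :&: W|) <= 32 * #|W|.
Proof.
set n := #|G| => T0 sumG.
have [W [sW degW sumW]] := delete_high_degree [set: G] (2 * T) n.
have cW : #|W| + #|[set: G] :\: W| = n.
  by rewrite setTD cardsC.
set D := #|_ :\: W| in sumW cW.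
have W2 : n ^ 2 + 2 * T * dsum W <= 2 * n * #|W|.
  have : 2 * T * dsum W + 2 * n * D <= n ^ 2 by apply: leq_trans sumW sumG.
  by rewrite -cW; clear; nia.
case: (posnP n) => [n0|n0].
  exists W; split; first by rewrite n0.
  by move=> x xW; have := degW x xW; rewrite n0.
have nW : n <= 2 * #|W|.
  have : n * n <= n * (2 * #|W|) by move: W2; clear; nia.
  by rewrite leq_pmul2l.
(* In the first alternative [W2] gives [33 * n <= 64 * #|W|], so a degree below [n / (2 * T)] is
   below [32 / 33] of [#|W| / T]. *)
case: (leqP (n ^ 2) (64 * T * dsum W)) => [big|small].
  exists W; split; first by move: nW; clear; lia.
  move=> x xW; have := degW x xW.
  have : 33 * n <= 64 * #|W|.
    rewrite -(leq_pmul2l n0); move: W2 big; clear.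
    by set a := T * dsum W; rewrite -!mulnA -/a; nia.
  by rewrite -mulnA; set a := T * _; clear; lia.
have [W' [sW' degW' sumW']] := delete_high_degree W (16 * T) n.
have cW' : #|W'| + #|W :\: W'| = #|W|.
  by rewrite -(cardsID W' W); have /setIidPr -> := sW'.
have D' : 8 * #|W :\: W'| <= n.
  have h : 8 * (n * #|W :\: W'|) <= n * n.
    by move: sumW' small; clear; set a := dsum W; set b := dsum W'; nia.
  by rewrite -(leq_pmul2l n0) mulnCA.
exists W'; split; first by move: D' cW' nW; clear; lia.
move=> x xW; have := degW' x xW; rewrite -mulnA; set a := T * _.
by move: D' cW' nW; clear; lia.
Qed.

Lemma dsum_edges : dsum [set: G] <= 2 * #|edges G|.
Proof.
pose A := [set p : G * G | adj p.1 p.2]; pose f (p : G * G) := [set p.1; p.2].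
have -> : dsum [set: G] = #|A|.
  rewrite /dsum pair_big /= -sum1_card [RHS]big_mkcond [LHS]big_mkcond /=.
  by apply: eq_bigr => p _; rewrite !inE /=; case: (adj _ _).
have EE : edges G = f @: A.
  by apply/setP => e; apply/imsetP/imsetP => -[p pA ->]; exists p; rewrite ?inE // in pA *.
rewrite EE -sum1_card (partition_big_imset f) /= mulnC -sum_nat_const.
apply: leq_sum => e /imsetP[[a b] _ ->].
rewrite sum1dep_card; apply: leq_trans (_ : #|[set (a, b); (b, a)]| <= 2); last first.
  by rewrite cards2; case: eqP.
apply/subset_leq_card/subsetP => -[x y]; rewrite !inE /f /= => /andP[xy /eqP E].
have xab : x \in [set a; b] by rewrite -E !inE eqxx.
have yab : y \in [set a; b] by rewrite -E !inE eqxx orbT.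
have nxy : x != y by apply: contraTneq xy => ->; rewrite adj_irr.
move: xab yab; rewrite !inE !xpair_eqE => /orP[]/eqP ex /orP[]/eqP ey;
  by move: nxy; rewrite ex ey ?eqxx ?orbT.
Qed.

End DegreeSum.

(** * Combination of the three cases *)

(** A set violating the hypothesis of one case becomes the ground set of the next, so the constants
    are fixed in reverse: [E2] for small balls, then [E1], then [M]. *)
Lemma coherent_weakly_linked t : 2 < t -> exists L, 0 < L /\ forall (G : sgraph) m,
  0 < m -> coherent G m -> L * m <= #|G| ->
  2 * t.-1 * dsum [set: G] <= #|G| ^ 2 -> weakly_linked G t.
Proof.
move=> t3; have t0 : 0 < t by apply: leq_trans t3.
have [e2 small] := small_balls_weakly_linked t0; pose E2 := e2.+1.
have [E1 [E10 focused]] := focused_weakly_linked t0 (ltn0Sn e2).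
(* The factor [2] absorbs the vertex itself when neighbourhoods become closed neighbourhoods. *)
have [|M [M0 dense]] := @dense_weakly_linked t (2 * E1) t3; first by rewrite muln_gt0.
exists (4 * M * (2 * E1 + 2 * E2)); split=> [|G m m0 coh mG sumG].
  by rewrite !muln_gt0 M0 addn_gt0 muln_gt0 E10.
have T0 : 0 < t.-1 by move: t3; clear; lia.
have [W [GW degW]] := low_degree_subset T0 sumG.
have mW : M * ((2 * E1 + 2 * E2) * m) <= #|W|.
  by rewrite -(@leq_pmul2l 4) // !mulnA; rewrite -!mulnA in mG *; apply: leq_trans mG GW.
have big (Z : {set G}) : #|W| <= M * #|Z| -> 2 * (E1 * m) + 2 * (E2 * m) <= #|Z|.
  by move=> h; rewrite !mulnA -mulnDl -(leq_pmul2l M0); apply: leq_trans mW h.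
have mle a : a <= a * m by rewrite leq_pmulr.
pose sparse (Z : {set G}) := [&& Z \subset W, #|W| <= M * #|Z| &
  [forall z in Z, 2 * E1 * #|nb z :&: Z| < #|Z|]].
case: (pickP sparse) => [Z /and3P[sZ WZ /forall_inP degZ]|no_sparse]; last first.
  apply: (dense G m W m0 coh _ degW).
    apply: leq_trans mW; rewrite leq_mul2l leq_pmull ?orbT //.
    by rewrite addn_gt0 muln_gt0 E10.
  move=> Z sZ WZ; have := no_sparse Z; rewrite /sparse sZ WZ /= => /negbT.
  by rewrite negb_forall_in => /exists_inP[z zZ]; rewrite -leqNgt; exists z.
have bigZ := big Z WZ.
have clZ z : z \in Z -> E1 * #|clnb Z [set z]| <= #|Z|.
  move=> zZ; have : #|clnb Z [set z]| <= #|nb z :&: Z| + 1.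
    rewrite addnC -(cards1 z); apply: leq_trans (leq_card_setU _ _).
    apply/subset_leq_card/subsetP => y; rewrite clnb1 !inE => /andP[-> /orP[/eqP->|->]].
      by rewrite eqxx.
    by rewrite orbT.
  move=> h; apply: leq_trans (_ : E1 * (#|nb z :&: Z| + 1) <= _).
    by rewrite leq_mul2l h orbT.
  have := degZ z zZ; have := mle E1; move: bigZ; clear.
  by rewrite mulnDr muln1 -mulnA; set a := E1 * #|_|; set b := E1 * m; lia.
pose unfocused (Z' : {set G}) := [&& Z' \subset Z, #|Z| <= 2 * #|Z'| &
  [forall v in Z', E2 * #|clnb Z' (clnb Z' [set v])| < #|Z'|]].
case: (pickP unfocused) => [Z' /and3P[sZ' ZZ' /forall_inP ballZ']|no_unf]; last first.
  apply: (focused G m Z m0 coh _ clZ).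
    by move: bigZ; clear; set a := E1 * m; set b := E2 * m; lia.
  move=> Z' sZ' ZZ'; have := no_unf Z'; rewrite /unfocused sZ' ZZ' /= => /negbT.
  by rewrite negb_forall_in => /exists_inP[v vZ]; rewrite -leqNgt; exists v.
apply: (small G m Z' m0 coh).
  have h : e2 * m <= E2 * m by rewrite leq_mul2r leqnSn orbT.
  by move: bigZ ZZ' h; clear; set a := E1 * m; set b := E2 * m; set d := e2 * m; lia.
move=> x xZ; apply: ltnW; apply: leq_ltn_trans (ballZ' x xZ).
by rewrite leq_mul2r leqnSn orbT.
Qed.

(** * Bi-cliques in the complement *)

Lemma anticomplete_biclique (G : sgraph) (A B : {set G}) m :
    [disjoint A & B] -> m <= #|A| -> m <= #|B| ->
    (forall a b, a \in A -> b \in B -> ~~ adj a b) ->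
  exists A' B' : {set compl G}, biclique A' B' /\ #|A'| = m.
Proof.
move=> dis mA mB nadj.
have [A' sA cA] := subset_of_size mA; have [B' sB cB] := subset_of_size mB.
exists A', B'; split=> //; split.
- apply: disjointI => x /(subsetP sA) xA /(subsetP sB).
  by rewrite (disjointFr dis xA).
- by rewrite cA cB.
move=> a b /(subsetP sA) aA /(subsetP sB) bB; rewrite /= /compl_adj nadj // andbT.
by apply: contraTneq bB => <-; rewrite (disjointFr dis aA).
Qed.

(** A complete graph has degree sum [n * (n - 1)], more than [n ^ 2 / (2 * T)] once [n] and [T] are
    at least two. This serves graphs too small for the coherence argument. *)
Lemma exists_nonadjacent (G : sgraph) T : 1 < T -> 1 < #|G| ->
  2 * T * dsum [set: G] <= #|G| ^ 2 -> exists x y : G, x != y /\ ~~ adj x y.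
Proof.
move=> T1 n1 sumG.
case: (pickP (fun p : G * G => (p.1 != p.2) && ~~ adj p.1 p.2)) => [[x y] /andP[]|no].
  by exists x, y.
have adjE (x y : G) : x != y -> adj x y.
  by move=> xy; have := no (x, y); rewrite /= xy => /negbFE.
have E : dsum [set: G] = #|G| * #|G|.-1.
  rewrite /dsum -sum_nat_const big_mkcond [RHS]big_mkcond /=; apply: eq_bigr => x _.
  rewrite inE -card_nbI; have -> : nb x :&: [set: G] = [set~ x].
    apply/setP => y; rewrite !inE andbT; case: (eqVneq y x) => [->|yx].
      by rewrite adj_irr.
    by rewrite adjE // eq_sym.
  by rewrite cardsC1.
exfalso; move: sumG; rewrite E; move: n1 T1; clear; case: #|G| => // n n1 T1 /=.
by nia.
Qed.

Local Open Scope ring_scope.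

Theorem theorem22 (R : realType) (t : nat) (ht : (3 <= t)%N) :
  exists delta : R, 0 < delta /\
    forall G : sgraph,
      #|G| <> 1%N ->
      #|edges G|%:R <= 1 / (2 * (t%:R - 1)) * (#|G|%:R ^+ 2 / 2) :> R ->
      ~ has_induced_weak_subdivision G (complete t) ->
      exists A B : {set compl G},
        biclique A B /\ delta * #|G|%:R <= #|A|%:R.
Proof.
have [L [L0 linked]] := coherent_weakly_linked ht.
have L2 : 0 < (2 * L)%:R :> R by rewrite ltr0n muln_gt0.
(* For [n >= L] the integer part of [n / L] is at least [n / (2 * L)]; for [n < L] a bi-clique of
   size one is large enough. *)
exists (2 * L)%:R^-1; split=> [|G n1 edgesG noK]; first by rewrite invr_gt0.
have delta_le m : (#|G| <= 2 * L * m)%N -> (2 * L)%:R^-1 * #|G|%:R <= m%:R :> R.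
  by move=> h; rewrite mulrC ler_pdivrMr // mulrC -natrM ler_nat.
have sumG : (2 * t.-1 * dsum [set: G] <= #|G| ^ 2)%N.
  have T0 : 0 < (t.-1)%:R :> R by rewrite ltr0n; move: ht; clear; lia.
  have tE : t%:R - 1 = (t.-1)%:R :> R.
    by rewrite -{1}(prednK (ltnW (ltnW ht))) -natr1 addrK.
  apply: leq_trans (_ : 4 * t.-1 * #|edges G| <= _)%N.
    by have := dsum_edges G; set a := dsum _; set b := #|_|; clear; nia.
  rewrite -(ler_nat R) natrX !natrM; move: edgesG; rewrite tE.
  move: (t.-1)%:R T0 (#|G|%:R : R) (#|edges G|%:R : R) => T T0 n e h.
  have -> : n ^+ 2 = 1 / (2 * T) * (n ^+ 2 / 2) * (4 * T) by field; rewrite gt_eqF.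
  by rewrite mulrC ler_pM2r // mulr_gt0.
have [G0|G0] := posnP #|G|.
  exists set0, set0; split; last by rewrite G0 cards0 mulr0.
  split=> //; first by rewrite disjoints_subset sub0set.
  by move=> a b; rewrite inE.
have [ltL|geL] := ltnP #|G| L.
  have [||x [y [xy nadj]]] := @exists_nonadjacent G t.-1 _ _ sumG.
  - by move: ht; clear; lia.
  - by move: n1 G0; clear; lia.
  have [||||A [B [AB cA]]] := @anticomplete_biclique G [set x] [set y] 1.
  - by rewrite disjoints1 inE.
  - by rewrite cards1.
  - by rewrite cards1.
  - by move=> a b /set1P -> /set1P ->.
  exists A, B; split=> //; rewrite cA; apply: delta_le.
  by move: ltL; clear; lia.
pose m := (#|G| %/ L)%N.
have m0 : (0 < m)%N by rewrite divn_gt0.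
have Gm : (#|G| <= 2 * L * m)%N.
  have := ltn_ceil #|G| L0; rewrite -/m mulSn => h.
  have : (L <= L * m)%N by rewrite leq_pmulr.
  by move: h; rewrite -mulnA (mulnC m); set x := (L * m)%N; clear; lia.
(* Such a pair yields the bi-clique directly; if there is none, [G] is coherent and the excluded
   weak subdivision appears. *)
pose pure (p : {set G} * {set G}) := [&& [disjoint p.1 & p.2], (m <= #|p.1|)%N,
  (m <= #|p.2|)%N & [forall a in p.1, forall b in p.2, ~~ adj a b]].
case: (pickP pure) => [[A B] /and4P[/= dis mA mB /forall_inP nadj]|no_pure].
  have [a b aA bB|A' [B' [AB cA]]] := @anticomplete_biclique G A B m dis mA mB.
    by have /forall_inP := nadj a aA; apply.
  by exists A', B'; split=> //; rewrite cA; apply: delta_le.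
case: noK; apply: linked_weak_subdivision; apply: (linked G m m0) => //; last first.
  by rewrite mulnC leq_divM.
move=> A B dis mA mB; have := no_pure (A, B); rewrite /pure /= dis mA mB /= => /negbT.
rewrite negb_forall_in => /exists_inP[a aA].
by rewrite negb_forall_in => /exists_inP[b bB /negPn ab]; exists a, b.
Qed.
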